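(* Let $R=\mathbb{Q}[x_1,\dots,x_{16}]$ and let $I(G)\subset R$ be the edge ideal of the circulant graph $G=C_{16}(1,4,8)$. There is no basic double G-link $I(G)=fB+A$ for any monomial ideal $B\subset R$; that is, there do not exist a homogeneous form $f\in R$, a homogeneous ideal $A\subset R$, and a monomial ideal $B\subset R$ such that $I(G)=fB+A$ is a basic double G-link of $B$ on $A$.
   Context: The circulant graph $C_{16}(1,4,8)$ has vertex set $\{1,\dots,16\}$, with $i\neq j$ adjacent if and only if $i-j\equiv \pm1,\pm4,$ or $8 \pmod{16}$. The edge ideal of a graph $G$ is $I(G)=(x_ix_j : \{i,j\}\in E(G))$ (here it has 40 monomial generators). Basic double G-link (in a standard graded polynomial ring $S$ over a field): all ideals are assumed proper, homogeneous, and saturated with respect to the ideal generated by the variables. An ideal is unmixed if all its associated primes have the same height. $S/A$ is generically Gorenstein if $(S/A)_P$ is Gorenstein for all minimal primes $P$ of $A$. Let $A\subset B$ be unmixed ideals of $S$ such that $S/A$ is Cohen--Macaulay and generically Gorenstein and $\operatorname{ht}(A)+1=\operatorname{ht}(B)$. Let $f\in S$ be homogeneous of degree $d>0$ with $A:f=A$. Then $C=fB+A$ is called a basic double G-link of degree $d$ of $B$ on $A$; the equation $C=fB+A$ is also called a basic double G-link. *)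

(* Defs.v *)
From HB Require Import structures.
From mathcomp Require Import all_boot all_algebra.
From mathcomp Require Import generic_quotient ring_quotient boolp.
From mathcomp Require Import mpoly ring.

Set Implicit Arguments.
Unset Strict Implicit.
Unset Printing Implicit Defensive.

Import GRing.Theory.
Local Open Scope ring_scope.

(* Proper ideals and prime ideals are the library's [idealr R] and
   [prime_idealr R]. These are boolean predicates; with the classical axioms of
   boolp, every Prop-valued ideal is of this form. *)

(* R_P is made of the pairs (a, s) with s outside P, modulo (a, s) ~ (b, t) iff
   w (a t - b s) = 0 for some w outside P. *)
Section Localization.
Local Open Scope quotient_scope.
Variables (R : comNzRingType) (P : prime_idealr R).

Definition denom := {s : R | s \notin P}.

Definition frac_equiv (x y : R * denom) : bool :=
  `[< exists2 w, w \notin P & w * (x.1 * sval y.2 - y.1 * sval x.2) = 0 >].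

Lemma denomM (s t : R) : s \notin P -> t \notin P -> s * t \notin P.
Proof. by move=> sP tP; rewrite prime_idealrM negb_or sP. Qed.

Lemma denom1_subproof : 1 \notin P. Proof. by rewrite idealr1. Qed.

Definition denom1 : denom := exist _ 1 denom1_subproof.
Definition denom_mul (s t : denom) : denom :=
  exist _ (sval s * sval t) (denomM (svalP s) (svalP t)).

Lemma frac_equiv_is_equiv : equiv_class_of frac_equiv.
Proof.
split=> [x|x y|y x z].
- by apply/asboolP; exists 1; rewrite ?idealr1 // subrr mulr0.
- apply/asboolP/asboolP => -[w wP E]; exists w => //;
    by rewrite -opprB mulrN E oppr0.
- move=> /asboolP[w wP E] /asboolP[v vP F]; apply/asboolP.
  exists (w * v * sval y.2); first by rewrite !denomM ?(svalP y.2).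
  have -> : w * v * sval y.2 * (x.1 * sval z.2 - z.1 * sval x.2) =
    v * sval z.2 * (w * (x.1 * sval y.2 - y.1 * sval x.2)) +
    w * sval x.2 * (v * (y.1 * sval z.2 - z.1 * sval y.2)) by ring.
  by rewrite E F !mulr0 addr0.
Qed.

Canonical frac_equiv_equiv := EquivRelPack frac_equiv_is_equiv.
Canonical frac_equiv_encModRel := defaultEncModRel frac_equiv.

Definition localization := {eq_quot frac_equiv}.

HB.instance Definition _ : EqQuotient _ frac_equiv localization :=
  EqQuotient.on localization.
HB.instance Definition _ := Choice.on localization.

Definition frac_zero : R * denom := (0, denom1).
Definition frac_one : R * denom := (1, denom1).
Definition frac_opp (x : R * denom) : R * denom := (- x.1, x.2).
Definition frac_add (x y : R * denom) : R * denom :=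
  (x.1 * sval y.2 + y.1 * sval x.2, denom_mul x.2 y.2).
Definition frac_mul (x y : R * denom) : R * denom :=
  (x.1 * y.1, denom_mul x.2 y.2).

Definition loc_zero : localization := \pi_localization frac_zero.
Definition loc_one : localization := \pi_localization frac_one.
Definition loc_opp (x : localization) : localization :=
  \pi_localization (frac_opp (repr x)).
Definition loc_add (x y : localization) : localization :=
  \pi_localization (frac_add (repr x) (repr y)).
Definition loc_mul (x y : localization) : localization :=
  \pi_localization (frac_mul (repr x) (repr y)).

Lemma loc_eqP (x y : R * denom) :
  (exists2 w, w \notin P & w * (x.1 * sval y.2 - y.1 * sval x.2) = 0) <->
  \pi_localization x = \pi_localization y.
Proof.
split=> [E|/eqmodP]; last by move/asboolP.
by apply/eqmodP; apply/asboolP.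
Qed.

Lemma loc_eq1 (x y : R * denom) : x.1 * sval y.2 = y.1 * sval x.2 ->
  \pi_localization x = \pi_localization y.
Proof.
move=> E; apply/loc_eqP; exists 1; first by rewrite idealr1.
by rewrite E subrr mulr0.
Qed.

Lemma repr_equiv (x : R * denom) :
  exists2 w, w \notin P &
    w * ((repr (\pi_localization x)).1 * sval x.2 -
         x.1 * sval (repr (\pi_localization x)).2) = 0.
Proof. by apply/loc_eqP; rewrite reprK. Qed.

Lemma loc_oppE x :
  loc_opp (\pi_localization x) = \pi_localization (frac_opp x).
Proof.
have [w wP E] := repr_equiv x.
apply/loc_eqP; exists w => //=.
by rewrite !mulNr -opprD mulrN E oppr0.
Qed.

Lemma loc_addE x y :
  loc_add (\pi_localization x) (\pi_localization y) =
  \pi_localization (frac_add x y).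
Proof.
have [w wP E] := repr_equiv x; have [v vP F] := repr_equiv y.
apply/loc_eqP; exists (w * v); first exact: denomM.
move: E F; set x' := repr _; set y' := repr _ => E F /=.
rewrite [LHS](_ : _ = v * sval y.2 * sval y'.2 *
    (w * (x'.1 * sval x.2 - x.1 * sval x'.2)) +
    w * sval x.2 * sval x'.2 * (v * (y'.1 * sval y.2 - y.1 * sval y'.2))).
  by rewrite E F !mulr0 addr0.
by ring.
Qed.

Lemma loc_mulE x y :
  loc_mul (\pi_localization x) (\pi_localization y) =
  \pi_localization (frac_mul x y).
Proof.
have [w wP E] := repr_equiv x; have [v vP F] := repr_equiv y.
apply/loc_eqP; exists (w * v); first exact: denomM.
move: E F; set x' := repr _; set y' := repr _ => E F /=.
rewrite [LHS](_ : _ = v * y'.1 * sval y.2 *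
    (w * (x'.1 * sval x.2 - x.1 * sval x'.2)) +
    w * x.1 * sval x'.2 * (v * (y'.1 * sval y.2 - y.1 * sval y'.2))).
  by rewrite E F !mulr0 addr0.
by ring.
Qed.

Lemma loc_ind (Q : localization -> Prop) :
  (forall x, Q (\pi_localization x)) -> forall x, Q x.
Proof. by move=> H x; rewrite -[x]reprK. Qed.

Lemma loc_addA : associative loc_add.
Proof.
elim/loc_ind=> x; elim/loc_ind=> y; elim/loc_ind=> z.
by rewrite !loc_addE; apply: loc_eq1 => /=; ring.
Qed.

Lemma loc_addC : commutative loc_add.
Proof.
elim/loc_ind=> x; elim/loc_ind=> y.
by rewrite !loc_addE; apply: loc_eq1 => /=; ring.
Qed.

Lemma loc_add0 : left_id loc_zero loc_add.
Proof.
by elim/loc_ind=> x; rewrite loc_addE; apply: loc_eq1 => /=; ring.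
Qed.

Lemma loc_addN : left_inverse loc_zero loc_opp loc_add.
Proof.
by elim/loc_ind=> x; rewrite loc_oppE loc_addE; apply: loc_eq1 => /=; ring.
Qed.

HB.instance Definition _ :=
  GRing.isZmodule.Build localization loc_addA loc_addC loc_add0 loc_addN.

Lemma loc_mulA : associative loc_mul.
Proof.
elim/loc_ind=> x; elim/loc_ind=> y; elim/loc_ind=> z.
by rewrite !loc_mulE; apply: loc_eq1 => /=; ring.
Qed.

Lemma loc_mulC : commutative loc_mul.
Proof.
elim/loc_ind=> x; elim/loc_ind=> y.
by rewrite !loc_mulE; apply: loc_eq1 => /=; ring.
Qed.

Lemma loc_mul1 : left_id loc_one loc_mul.
Proof.
by elim/loc_ind=> x; rewrite loc_mulE; apply: loc_eq1 => /=; ring.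
Qed.

Lemma loc_mulDl : left_distributive loc_mul loc_add.
Proof.
elim/loc_ind=> x; elim/loc_ind=> y; elim/loc_ind=> z.
by rewrite !(loc_mulE, loc_addE); apply: loc_eq1 => /=; ring.
Qed.

Lemma loc_one_neq0 : loc_one != 0.
Proof.
apply/eqP => /loc_eqP[w wP] /=.
by rewrite !mulr1 subr0 mulr1 => w0; rewrite w0 rpred0 in wP.
Qed.

HB.instance Definition _ := GRing.Zmodule_isComNzRing.Build localization
  loc_mulA loc_mulC loc_mul1 loc_mulDl loc_one_neq0.

End Localization.

Section CommutativeAlgebra.
Variable R : comNzRingType.
Implicit Types (I J M : idealr R) (P Q : prime_idealr R).

Definition ideal_gen (G : R -> Prop) (x : R) : Prop :=
  exists (k : nat) (c g : 'I_k -> R),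
    (forall i, G (g i)) /\ x = \sum_i c i * g i.

Definition ideal_pow (J : R -> Prop) (k : nat) : R -> Prop :=
  ideal_gen (fun y => exists x : 'I_k -> R, (forall i, J (x i)) /\ y = \prod_i x i).

Definition colon I (f : R) : {pred R} := [pred g | f * g \in I].

Definition maximal_ideal I : Prop :=
  forall J, {subset I <= J} -> {subset J <= I}.

(* d is the largest length at which C holds, for C closed under shortening. *)
Definition max_length (C : nat -> Prop) (d : nat) : Prop := C d /\ ~ C d.+1.

(* c 0 < c 1 < ... < c k ; the values c i for i > k are irrelevant. *)
Definition prime_chain (c : nat -> prime_idealr R) (k : nat) : Prop :=
  forall i, (i < k)%N ->
    {subset c i <= c i.+1} /\ ~ {subset c i.+1 <= c i}.

Definition krull_dim : nat -> Prop :=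
  max_length (fun k => exists c, prime_chain c k).

Definition prime_height P : nat -> Prop :=
  max_length (fun k => exists c, prime_chain c k /\ c k =i P).

Definition ideal_height I (h : nat) : Prop :=
  (exists P, {subset I <= P} /\ prime_height P h) /\
  (forall P k, {subset I <= P} -> prime_height P k -> (h <= k)%N).

Definition associated_prime I P : Prop := exists x, P =i colon I x.

Definition unmixed I : Prop :=
  exists h, forall P, associated_prime I P -> prime_height P h.

Definition minimal_prime P : Prop :=
  forall Q, {subset Q <= P} -> {subset P <= Q}.

Definition regular_seq (s : seq R) : Prop :=
  let J i := ideal_gen (fun y => y \in take i s) in
  (forall i y, (i < size s)%N -> J i (s`_i * y) -> J i y) /\ ~ J (size s) 1.

Definition depth M : nat -> Prop :=
  max_length (fun k =>
    exists s, [/\ size s = k, {subset s <= M} & regular_seq s]).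

Definition local_ring_with M : Prop := forall J, {subset J <= M}.

Definition CohenMacaulay_local : Prop :=
  exists M, local_ring_with M /\ exists d, krull_dim d /\ depth M d.

Definition injective_module (E : lmodType R) : Prop :=
  forall (U V : lmodType R) (i : {linear U -> V}) (g : {linear U -> E}),
    injective i -> exists h : {linear V -> E}, forall x, h (i x) = g x.

(* A finite injective resolution 0 -> N -> E 0 -> E 1 -> ... -> E n -> 0. *)
Definition finite_injective_dim (N : lmodType R) : Prop :=
  exists (n : nat) (E : nat -> lmodType R)
      (d : forall i, {linear E i -> E i.+1}) (eta : {linear N -> E 0%N}),
    [/\ injective eta,
        forall x, d 0%N x = 0 <-> exists y, x = eta y,
        forall i x, d i.+1 x = 0 <-> exists y, x = d i y,
        forall i, injective_module (E i) &
        forall i, (n < i)%N -> forall x : E i, x = 0].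

(* Meant for Noetherian local rings. *)
Definition Gorenstein_local : Prop := finite_injective_dim R^o.

End CommutativeAlgebra.

Definition CohenMacaulay (R : comNzRingType) : Prop :=
  forall M : prime_idealr R, maximal_ideal M ->
    CohenMacaulay_local (localization M).

(* For R = S/A, the minimal primes of R are the P/A with P a minimal prime of
   A, and the localization of R at P/A is (S/A)_P. *)
Definition generically_Gorenstein (R : comNzRingType) : Prop :=
  forall P : prime_idealr R, minimal_prime P ->
    Gorenstein_local (localization P).

Section PolynomialIdeals.
Variables (K : fieldType) (n : nat).
Local Notation S := {mpoly K[n]}.

Definition homogeneous_ideal (I : idealr S) : Prop :=
  forall g d, g \in I -> pihomog mdeg d g \in I.

Definition irrelevant_ideal : S -> Prop :=
  ideal_gen (fun p => exists i : 'I_n, p = 'X_i).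

Definition saturated (I : idealr S) : Prop :=
  forall g, (exists k, forall u, ideal_pow irrelevant_ideal k u -> u * g \in I) ->
    g \in I.

Definition monomial_ideal (I : idealr S) : Prop :=
  exists M : 'X_{1..n} -> Prop, forall g,
    g \in I <-> ideal_gen (fun p => exists2 m, M m & p = 'X_[m]) g.

(* C = f B + A is a basic double G-link of degree d of B on A. *)
Record basic_double_Glink (d : nat) (f : S) (A B C : idealr S) : Prop := {
  bdl_homogeneous :
    [/\ homogeneous_ideal A, homogeneous_ideal B & homogeneous_ideal C];
  bdl_saturated : [/\ saturated A, saturated B & saturated C];
  bdl_sub : {subset A <= B};
  bdl_unmixed : unmixed A /\ unmixed B;
  bdl_CM : CohenMacaulay {ideal_quot A};
  bdl_generically_Gorenstein : generically_Gorenstein {ideal_quot A};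
  bdl_height : exists h, ideal_height A h /\ ideal_height B h.+1;
  bdl_degree : (0 < d)%N /\ f \is d.-homog;
  bdl_colon : colon A f =i A;
  bdl_eq : forall g,
    g \in C <-> exists a b, [/\ a \in A, b \in B & g = f * b + a]
}.

(* The edge ideal of the graph on 'I_n with adjacency relation e. *)
Variable e : rel 'I_n.

Definition edge_ideal : {pred S} := fun g =>
  `[< ideal_gen (fun p => exists i j, e i j /\ p = 'X_i * 'X_j) g >].

Lemma edge_ideal_closed : idealr_closed edge_ideal.
Proof.
split.
- apply/asboolP; exists 0%N, (fun=> 0), (fun=> 0); split; first by case.
  by rewrite big_ord0.
- apply/negP => /asboolP[k [c [g [gE]]]] /(congr1 (meval (fun=> 0))).
  rewrite meval1 raddf_sum big1 => [/eqP|i _]; first by rewrite oner_eq0.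
  have [i1 [i2 [_ ->]]] := gE i.
  by rewrite /= !mevalM mevalXU mul0r mulr0.
- move=> a u v /asboolP[k [c [g [gE ->]]]] /asboolP[l [c' [g' [gE' ->]]]].
  apply/asboolP; exists (k + l)%N.
  exists (fun i => match split i with inl j => a * c j | inr j => c' j end).
  exists (fun i => match split i with inl j => g j | inr j => g' j end).
  split=> [i|]; first by case: split.
  rewrite big_split_ord /= mulr_sumr; congr (_ + _); apply: eq_bigr => i _.
    by rewrite (unsplitK (inl _ i)) mulrA.
  by rewrite (unsplitK (inr _ i)).
Qed.

HB.instance Definition _ := isIdealr.Build S edge_ideal edge_ideal_closed.

End PolynomialIdeals.

Arguments edge_ideal K {n} e.

(* The circulant graph C_n(s), on {0, ..., n-1} instead of {1, ..., n}: i and j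
   are adjacent iff i <> j and i - j = t or -t modulo n for some t in s. *)
Definition circulant (n : nat) (s : seq nat) : rel 'I_n := fun i j =>
  (i != j) &&
  has (fun t => (i == j + t %[mod n])%N || (j == i + t %[mod n])%N) s.

Arguments circulant : clear implicits.

(* Main.v *)
Require Import Defs.
From HB Require Import structures.
From mathcomp Require Import all_boot all_order all_algebra.
From mathcomp Require Import generic_quotient ring_quotient boolp.
From mathcomp Require Import mpoly ring lra.
From mathcomp Require classical_sets.

Set Implicit Arguments.
Unset Strict Implicit.
Unset Printing Implicit Defensive.

Import GRing.Theory.
Local Open Scope ring_scope.

(** Let I be the edge ideal of G = C_16(1,4,8), and suppose that I = f B + A is a
basic double G-link with B a monomial ideal.

Degrees force f to be a linear form. If every edge monomial were in A, then
I = A, so f B lies in A, so B = A because f is a nonzerodivisor modulo A; but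
B has larger height than A. So some edge is f b + a with f b not in A, and
comparing terms of degree 2 leaves only deg f = 1 and a variable x_v in B
([link_linear]). As I is a monomial ideal, f = sum of c_t x_t over a nonempty
set T of neighbours of v.

Suppose that T has at least two elements ([no_link_two]). The triangles of G lie in the
cosets of 4Z, which are K_4's. So if T is a clique then T and v lie in one
coset; otherwise T contains two non-adjacent vertices. In both cases there are
an independent set sigma, a maximal independent set F that contains sigma and
meets T, and a point p with support sigma, such that f(p) = 0 and x_sigma B is
contained in I. Then x_sigma I lies in A + f I, and the determinant trick gives
u with u I in A and u(p) nonzero. Hence the prime P of the variables outside F
is an associated prime of A, and P contains B since f is not in P. As A is
unmixed, P has the height of A, which is less than the height of B: this is
absurd ([link_obstruction]). Here the height of A is attained at a prime which
is minimal over A; that this one is associated to A as well uses that it is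
finitely generated ([hilbert_basis], [minimal_over_associated]).

Suppose that f = c x_t ([no_link_one]). Then S/(A, f) = S/(I, x_t), the
Stanley-Reisner ring of the complex D of independent sets of G avoiding t. It
has dimension 4, but it is not Cohen-Macaulay, as D has nonzero second
cohomology (its reduced Euler characteristic is 1), whereas f is a
nonzerodivisor modulo A and S/A is Cohen-Macaulay of dimension 5. To make this
elementary, localize S/A at the origin. A chain of primes of length 5 exists
there: four steps up from the prime of a facet of D, and one step down
from it, because x_t is a nonzerodivisor modulo A that belongs to this prime
([single_prime_chain]). So the local ring has a regular sequence of length 5.
This makes a Koszul-type cochain complex on the variables acyclic in degrees
below 5 ([regular_seq_acyclic]), hence acyclic in degrees below 4 modulo f
([acyclic_quotient]). But a 2-cocycle of D with coefficients a_ijk gives the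
cocycle a_ijk x_i x_j x_k of degree 3, and an explicit one, supported on five
triangles, has value 1 on an octahedron in D, so that it is not a coboundary
([tri_cochain_not_coboundary]). *)

(** * Ideals, prime ideals and associated primes *)

Section Ideals.
Variable R : comNzRingType.
Implicit Types (I J : idealr R) (P Q : prime_idealr R).

Definition mk_ideal (S : {pred R}) (H : idealr_closed S) : idealr R :=
  HB.pack (S : R -> bool) (isIdealr.Build R S H).

Definition mk_prime (S : {pred R}) (H : idealr_closed S)
    (H' : prime_idealr_closed S) : prime_idealr R :=
  HB.pack (S : R -> bool) (isIdealr.Build R S H)
    (isPrimeIdealrClosed.Build R S H').

Lemma ideal_gen_sub I (G : R -> Prop) x :
  (forall g, G g -> g \in I) -> ideal_gen G x -> x \in I.
Proof.
move=> GI [k [c [g [gG ->]]]].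
by apply: rpred_sum => i _; apply: idealMr; apply: GI.
Qed.

Lemma ideal_gen0 (G : R -> Prop) : ideal_gen G 0.
Proof.
by exists 0%N, (fun=> 0), (fun=> 0); split=> [[]|] //; rewrite big_ord0.
Qed.

Lemma ideal_genP (G : R -> Prop) a u v :
  ideal_gen G u -> ideal_gen G v -> ideal_gen G (a * u + v).
Proof.
move=> [k [c [g [gE ->]]]] [l [c' [g' [gE' ->]]]].
exists (k + l)%N.
exists (fun i => match split i with inl j => a * c j | inr j => c' j end).
exists (fun i => match split i with inl j => g j | inr j => g' j end).
split=> [i|]; first by case: split.
rewrite big_split_ord /= mulr_sumr; congr (_ + _); apply: eq_bigr => i _.
  by rewrite (unsplitK (inl _ i)) mulrA.
by rewrite (unsplitK (inr _ i)).
Qed.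

Lemma ideal_gen1 (G : R -> Prop) x : G x -> ideal_gen G x.
Proof.
move=> Gx; exists 1%N, (fun=> 1), (fun=> x); split=> //.
by rewrite big_ord1 mul1r.
Qed.

Lemma ideal_gen_incl (G G' : R -> Prop) x :
  (forall y, G y -> G' y) -> ideal_gen G x -> ideal_gen G' x.
Proof. by move=> GG [k [c [g [gE ->]]]]; exists k, c, g; split=> // i; apply: GG. Qed.

Lemma ideal_gen_elim (G H : R -> Prop) x :
  H 0 -> (forall a u v, H u -> H v -> H (a * u + v)) ->
  (forall g, G g -> H g) -> ideal_gen G x -> H x.
Proof.
move=> H0 HP GH [k [c [g [gG ->]]]].
elim/big_ind: _ => // [u v Hu Hv|i _]; first by rewrite -[u]mul1r; apply: HP.
by rewrite -[_ * _]addr0; apply: HP => //; apply: GH.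
Qed.

Lemma ideal_gen_rcons (s : seq R) y x :
  ideal_gen (fun z => z \in rcons s y) x ->
  exists w a, ideal_gen (fun z => z \in s) a /\ x = a + y * w.
Proof.
move=> xG; pattern x; apply: ideal_gen_elim xG.
- by exists 0, 0; split; [apply: ideal_gen0 | rewrite mulr0 addr0].
- move=> a u v [w [b [bs ->]]] [w' [b' [bs' ->]]].
  exists (a * w + w'), (a * b + b'); split; first exact: ideal_genP.
  by rewrite mulrDr mulrDr addrACA mulrCA.
- move=> g; rewrite mem_rcons inE => /predU1P[->|gs].
    by exists 1, 0; split; [apply: ideal_gen0 | rewrite add0r mulr1].
  by exists 0, g; split; [apply: ideal_gen1 | rewrite mulr0 addr0].
Qed.

End Ideals.

Section KernelPrime.
Variables (R : comNzRingType) (D : idomainType) (phi : {rmorphism R -> D}).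

Definition kernel : {pred R} := fun x => phi x == 0.

Lemma kernelE x : (x \in kernel) = (phi x == 0). Proof. by []. Qed.

Lemma kernel_closed : idealr_closed kernel.
Proof.
split; rewrite ?kernelE ?rmorph0 ?rmorph1 ?oner_eq0 //.
move=> a u v; rewrite !kernelE => /eqP u0 /eqP v0.
by rewrite rmorphD rmorphM u0 v0 mulr0 addr0.
Qed.

Lemma kernel_prime_closed : prime_idealr_closed kernel.
Proof. by move=> u v; rewrite !kernelE rmorphM mulf_eq0. Qed.

Definition kernel_prime : prime_idealr R :=
  mk_prime kernel_closed kernel_prime_closed.

End KernelPrime.

Section Zorn.
Import classical_sets.
Local Open Scope classical_set_scope.
Variable R : comNzRingType.
Implicit Types (I J : idealr R) (P Q : prime_idealr R).

(** The usual argument that an ideal maximal among those disjoint from a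
multiplicative set is prime. Zorn's lemma is applied to sets that are either empty or
ideals containing [I], since the union of the empty chain is empty. *)
Lemma prime_avoiding I (U : R -> Prop) :
  U 1 -> (forall x y, U x -> U y -> U (x * y)) ->
  (forall x, U x -> x \notin I) ->
  exists P : prime_idealr R, {subset I <= P} /\ forall x, U x -> x \notin P.
Proof.
move=> U1 UM UI.
pose good (S : set R) := [/\ forall x, x \in I -> S x,
  forall a u v, S u -> S v -> S (a * u + v) & forall x, U x -> ~ S x].
have goodI : good [set x | x \in I].
  split=> // [a u v uI vI|x Ux xI]; last by have := UI _ Ux; rewrite xI.
  by apply: rpredD => //; apply: idealMr.
have [F FP|S [gS maxS]] := @Zorn_bigcup _ (fun S => S = set0 \/ good S).
  move=> totF; have [[X0 FX0 gX0]|noX] := EM (exists2 X, F X & good X).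
    right; split=> [x xI|a u v [X FX Xu] [Y FY Yv]|x Ux [X FX Xx]].
    - by exists X0 => //; case: gX0 => + _ _; apply.
    - have gX : good X by case: (FP _ FX) => // X0'; rewrite X0' in Xu.
      have gY : good Y by case: (FP _ FY) => // Y0; rewrite Y0 in Yv.
      have [XY|YX] := totF X Y FX FY.
        by exists Y => //; case: gY => _ + _; apply=> //; apply: XY.
      by exists X => //; case: gX => _ + _; apply=> //; apply: YX.
    - have [X0'|[_ _ /(_ x Ux)]] := FP _ FX; last by [].
      by rewrite X0' in Xx.
  left; apply/seteqP; split=> x // [X FX Xx].
  have [X0|gX] := FP _ FX; first by rewrite X0 in Xx.
  by apply: noX; exists X.
have {gS}[SI SP SU] : good S.
  case: gS => // S0; exfalso; apply: (maxS [set x | x \in I]); last by right.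
  rewrite S0; split=> // /(_ 0); apply.
  by rewrite /= rpred0.
have S0 : S 0 by apply: SI; rewrite rpred0.
pose p : {pred R} := fun x => `[< S x >].
have pcl : idealr_closed p.
  split; first exact/asboolP.
    by apply/negP => /asboolP; apply: SU.
  by move=> a u v /asboolP uS /asboolP vS; apply/asboolP; apply: SP.
have grow u : ~ S u -> exists2 x, U x & exists a r, S a /\ x = a + r * u.
  move=> nSu; apply: contrapT => no.
  apply: (maxS (fun x => exists a r, S a /\ x = a + r * u)).
    split; first by move=> x Sx; exists x, 0; rewrite mul0r addr0.
    by move=> /(_ u) uS; apply: nSu; apply: uS; exists 0, 1; rewrite mul1r add0r.
  right; split=> [x xI|c x y [a [r [Sa ->]]] [b [s [Sb ->]]]|x Ux xS].
  - by exists x, 0; rewrite mul0r addr0; split=> //; apply: SI.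
  - exists (c * a + b), (c * r + s); split; first exact: SP.
    by rewrite mulrDr mulrDl addrACA mulrA.
  - by apply: no; exists x.
have ppr : prime_idealr_closed p.
  move=> u v /asboolP Suv; apply/orP.
  have [Su|nSu] := EM (S u); first by left; apply/asboolP.
  have [Sv|nSv] := EM (S v); first by right; apply/asboolP.
  exfalso; have [x Ux [a [r [Sa xE]]]] := grow _ nSu.
  have [y Uy [b [s [Sb yE]]]] := grow _ nSv.
  apply: (SU _ (UM _ _ Ux Uy)).
  have -> : x * y = y * a + ((r * u) * b + ((r * s) * (u * v) + 0)).
    by rewrite xE yE; ring.
  by do 3!apply: (SP) => //.
exists (mk_prime pcl ppr); split=> [x xI|x Ux]; first by apply/asboolP; apply: SI.
by apply/negP => /asboolP; apply: SU.
Qed.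

End Zorn.

Section AssociatedPrimes.
Variable R : comNzRingType.
Implicit Types (I : idealr R) (P Q : prime_idealr R).

(** Applied to the multiplicative set of the x^k s with s outside P. When x is in P
the prime obtained is strictly smaller than P: this replaces Krull's height theorem. *)
Lemma prime_below_avoiding I P x :
  (forall k s, s \notin P -> x ^+ k * s \notin I) ->
  exists Q, [/\ {subset I <= Q}, {subset Q <= P} & x \notin Q].
Proof.
move=> xI.
have [||y [k [s [sP ->]]]|Q [IQ UQ]] :=
  @prime_avoiding R I (fun y => exists k s, s \notin P /\ y = x ^+ k * s).
- by exists 0%N, 1; rewrite idealr1 expr0 mulr1.
- move=> y z [k [s [sP ->]]] [l [t [tP ->]]]; exists (k + l)%N, (s * t).
  by rewrite denomM // exprD mulrACA.
- exact: xI.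
exists Q; split=> // [y yQ|].
  apply: contraT => yP; suff: y \notin Q by rewrite yQ.
  by apply: UQ; exists 0%N, y; rewrite mul1r.
by apply: UQ; exists 1%N, 1; rewrite idealr1 expr1 mulr1.
Qed.

Lemma minimal_over_nilpotent I P x :
  (forall Q, {subset I <= Q} -> {subset Q <= P} -> {subset P <= Q}) ->
  x \in P -> exists k s, s \notin P /\ x ^+ k * s \in I.
Proof.
move=> minP xP; apply: contrapT => no.
have [k s sP|Q [IQ QP]] := @prime_below_avoiding I P x; last by rewrite (minP Q).
by apply/negP => xsI; apply: no; exists k, s.
Qed.

(** In a Noetherian ring the minimal primes over an ideal are associated to it.
Only the finite generation of P matters: P is nilpotent in the localization of R/I at P,
so some nonzero element there is killed by all generators of P. *)
Lemma minimal_over_associated I P (ps : seq R) : {subset I <= P} ->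
  (forall Q, {subset I <= Q} -> {subset Q <= P} -> {subset P <= Q}) ->
  {subset ps <= P} -> (forall x, x \in P -> ideal_gen (fun y => y \in ps) x) ->
  associated_prime I P.
Proof.
move=> IP minP psP Pps.
(* g is nonzero in the localization of R/I at P and is killed there by ps; it is
   obtained from 1 by multiplying with a maximal power of each generator. *)
have: exists g, (forall s, s \notin P -> s * g \notin I) /\
    forall x, x \in ps -> exists2 s, s \notin P & s * (x * g) \in I.
  elim: ps psP {Pps} => [|x ps IH] psP.
    exists 1; split=> // s sP; rewrite mulr1.
    by apply: contra sP; apply: IP.
  have [|g [gI gps]] := IH.
    by move=> y yps; apply: psP; rewrite inE yps orbT.
  have [k [t [tP tI]]] := minimal_over_nilpotent minP (psP _ (mem_head _ _)).
  have ex : exists m, `[< exists2 s, s \notin P & s * (x ^+ m * g) \in I >].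
    exists k; apply/asboolP; exists t => //.
    have -> : t * (x ^+ k * g) = g * (x ^+ k * t) by ring.
    exact: idealMr.
  case: (ex_minnP ex) => m /asboolP[s sP sI] minm.
  case: m => [|m] in sI minm *.
    by move: sI; rewrite expr0 mul1r (negbTE (gI _ sP)).
  exists (x ^+ m * g); split=> [r rP|y].
    apply/negP => rI; have := minm m; rewrite ltnn => H.
    by have /H : `[< exists2 s, s \notin P & s * (x ^+ m * g) \in I >]
      by apply/asboolP; exists r.
  rewrite inE => /predU1P[->|/gps[r rP rI]].
    by exists s => //; rewrite [x * _]mulrA -exprS.
  exists r => //; have -> : r * (y * (x ^+ m * g)) = x ^+ m * (r * (y * g)) by ring.
  exact: idealMr.
move=> [g [gI gps]].
have [s sP sI] : exists2 s, s \notin P & forall x, x \in ps -> s * (x * g) \in I.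
  elim: ps gps {psP Pps} => [|x ps IH] gps; first by exists 1; rewrite ?idealr1.
  have [|s sP sI] := IH; first by move=> y yps; apply: gps; rewrite inE yps orbT.
  have [t tP tI] := gps _ (mem_head _ _).
  exists (s * t) => [|y]; first exact: denomM.
  rewrite inE => /predU1P[->|/sI yI]; first by rewrite -mulrA idealMr.
  by rewrite [s * t]mulrC -mulrA idealMr.
exists (s * g) => y; apply/idP/idP; rewrite inE /= => yP.
  pattern y; apply: ideal_gen_elim (Pps _ yP).
  - by rewrite mulr0 rpred0.
  - by move=> a u v uI vI; rewrite mulrDr mulrCA rpredD // idealMr.
  - by move=> x /sI; rewrite mulrAC mulrA.
apply: contraLR yP => yP; rewrite -mulrA [g * y]mulrC mulrA.
by apply: gI; apply: denomM.
Qed.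

(** Nakayama's lemma for an ideal E generated by the e_i: if s E is contained in
I + f E, then u = det(s - f c) sends E into I, and u is s^N modulo f. The morphism phi
stands for evaluation at a point where f vanishes and s does not. *)
Lemma determinant_trick (K : comNzRingType) (phi : {rmorphism R -> K}) N
    (e : 'I_N -> R) I (f s : R) :
  phi f = 0 ->
  (forall i, exists2 a, a \in I & exists c : 'I_N -> R,
     s * e i = a + f * \sum_k c k * e k) ->
  exists u, phi u = phi s ^+ N /\ forall i, u * e i \in I.
Proof.
move=> f0 H.
have {H} H i : exists c : 'I_N -> R, s * e i - f * \sum_k c k * e k \in I.
  by have [a aI [c ->]] := H i; exists c; rewrite addrK.
have [c cE] := choice H.
pose M : 'M[R]_N := s%:M - f *: \matrix_(i, j) c i j.
exists (\det M); split.
  rewrite -det_map_mx -det_scalar; congr (\det _); apply/matrixP => i j; rewrite !mxE.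
  by rewrite rmorphB rmorphM f0 mul0r subr0 rmorphMn.
move=> i; pose E : 'cV[R]_N := \col_k e k.
have -> : \det M * e i = (\adj M *m (M *m E)) i 0.
  by rewrite mulmxA mul_adj_mx mul_scalar_mx !mxE.
rewrite mxE; apply: rpred_sum => k _; apply: idealMr.
suff -> : (M *m E) k 0 = s * e k - f * \sum_j c k j * e j by [].
rewrite mulmxBl mul_scalar_mx -scalemxAl !mxE; congr (_ - _ * _).
by apply: eq_bigr => j _; rewrite !mxE.
Qed.

End AssociatedPrimes.

(** * A Koszul-type complex that detects regular sequences *)

Section Koszul.
Variables (R : comNzRingType) (n : nat) (x : 'I_n -> R).
Implicit Types (g h : seq 'I_n -> R) (J : R -> Prop).

(** The differential of a complex of all functions on tuples of indices, without any
alternation: for s = [:: i_0; ...; i_k] it is the sum of (-1)^p x_{i_p} g(s without i_p).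
Dropping alternation makes the recursion on s immediate and keeps the two identities
that matter, [cobdK] and [cobd_contract]. *)
Fixpoint cobd g (s : seq 'I_n) : R :=
  if s is i :: s' then x i * g s' - cobd (fun t => g (i :: t)) s' else 0.

Lemma eq_cobd_size g h s :
  (forall t, size t = (size s).-1 -> g t = h t) -> cobd g s = cobd h s.
Proof.
elim: s g h => //= i s IH g h gh; rewrite gh //; congr (_ - _).
by case: s IH gh => // j s IH gh; apply: IH => t ts; apply: gh; rewrite /= ts.
Qed.

Lemma cobdP a g h s :
  cobd (fun t => a * g t + h t) s = a * cobd g s + cobd h s.
Proof.
elim: s g h => /= [|i s IH] g h; first by rewrite mulr0 addr0.
by rewrite IH; ring.
Qed.

Lemma cobd_sum m (c : 'I_m -> R) (G : 'I_m -> seq 'I_n -> R) s :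
  cobd (fun t => \sum_j c j * G j t) s = \sum_j c j * cobd (G j) s.
Proof.
elim: s G => [|i s IH] G /=; first by rewrite big1 // => j _; rewrite mulr0.
rewrite IH mulr_sumr -sumrB; apply: eq_bigr => j _.
by rewrite mulrBr mulrCA.
Qed.

Lemma cobdN g s : cobd (fun t => - g t) s = - cobd g s.
Proof. by elim: s g => /= [|i s IH] g; rewrite ?oppr0 // IH; ring. Qed.

Lemma cobdK g s : cobd (cobd g) s = 0.
Proof.
elim: s g => //= i s IH g.
by rewrite cobdP (cobdN (cobd (fun t => g (i :: t)))) IH; ring.
Qed.

(** The null-homotopy for multiplication by y = sum of c_j x_j. *)
Definition contract (c : 'I_n -> R) g (s : seq 'I_n) : R :=
  \sum_j c j * g (j :: s).

Lemma cobd_contract c g s :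
  cobd (contract c g) s = (\sum_j c j * x j) * g s - contract c (cobd g) s.
Proof.
rewrite /contract (cobd_sum c (fun j t => g (j :: t))) mulr_suml -sumrB.
by apply: eq_bigr => j _ /=; ring.
Qed.

Definition submodule J := J 0 /\ forall a u v, J u -> J v -> J (a * u + v).

Lemma submoduleN J u : submodule J -> J u -> J (- u).
Proof. by move=> [J0 JP] Ju; have := JP (-1) _ _ Ju J0; rewrite addr0 mulN1r. Qed.

Lemma submoduleD J u v : submodule J -> J u -> J v -> J (u + v).
Proof. by move=> [J0 JP] Ju Jv; rewrite -[u]mul1r; apply: JP. Qed.

Lemma submoduleM J a u : submodule J -> J u -> J (a * u).
Proof. by move=> [J0 JP] Ju; rewrite -[a * u]addr0; apply: JP. Qed.

Lemma submodule_sum J (I : finType) (F : I -> R) :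
  submodule J -> (forall i, J (F i)) -> J (\sum_i F i).
Proof.
move=> sJ JF; elim/big_ind: _ => //; first by case: sJ.
by move=> u v; apply: submoduleD.
Qed.

Lemma cobd_submodule J k g : submodule J ->
  (forall s, size s = k -> J (g s)) -> forall s, size s = k.+1 -> J (cobd g s).
Proof.
move=> sJ; elim: k g => [|k IH] g Jg [|i s] //= [sk].
  case: s sk => //= _; rewrite subr0; apply: submoduleM => //.
  exact: Jg.
apply: submoduleD => //; first by apply: submoduleM => //; apply: Jg.
by apply: submoduleN => //; apply: IH => // t tk; apply: Jg; rewrite /= tk.
Qed.

(** The vanishing of the cohomology in degree k of the complex with coefficients in R/J.
Keeping J as a predicate avoids changing the ring along a regular sequence. *)
Definition acyclic_mod J k := forall g,
  (forall s, size s = k.+1 -> J (cobd g s)) ->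
  exists h, forall s, size s = k -> J (g s - cobd h s).

Definition span (y : R) J (z : R) := exists w a, J a /\ z = a + y * w.

(** One step down a regular sequence. If g is a cocycle mod J, its contraction u by y
satisfies d u = y g mod J, so u is a cocycle mod (J, y), hence u = d h + y w mod (J, y),
whence y g = y d w mod J, and y can be cancelled. *)
Lemma acyclic_span J y k : submodule J ->
  (exists c, y = \sum_j c j * x j) ->
  (forall z, J (y * z) -> J z) ->
  (forall l, (l < k)%N -> acyclic_mod (span y J) l) ->
  forall l, (l < k.+1)%N -> acyclic_mod J l.
Proof.
move=> sJ [c yE] reg acy l lk g Jg.
have J0 : J 0 by case: sJ.
case: l => [|l] in lk Jg *.
  exists (fun=> 0) => s /size0nil -> /=; rewrite subr0; apply: reg.
  rewrite yE mulr_suml; apply: submodule_sum => // j.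
  rewrite -mulrA; apply: submoduleM => //.
  by have := Jg [:: j] erefl; rewrite /= subr0.
have Jy s : size s = l.+1 -> J (cobd (contract c g) s - y * g s).
  move=> sl; rewrite cobd_contract -yE addrAC subrr add0r.
  apply: submoduleN => //; apply: submodule_sum => // j.
  by apply: submoduleM => //; apply: Jg; rewrite /= sl.
have [|h hE] := acy l lk (contract c g).
  move=> s sl; exists (g s), (cobd (contract c g) s - y * g s); split; first exact: Jy.
  by rewrite subrK.
have {hE} hE s : exists w, size s = l -> J (contract c g s - cobd h s - y * w).
  have [sl|] := EM (size s = l); last by exists 0.
  by have [w [a [Ja ->]]] := hE _ sl; exists w; rewrite addrK.
have [w wE] := choice hE; exists w => s sl; apply: reg.
rewrite (_ : _ * _ = - (cobd (contract c g) s - y * g s) +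
   cobd (fun t => -1 * cobd h t + ((- y) * w t + contract c g t)) s).
  apply: submoduleD => //; first by apply: submoduleN => //; apply: Jy.
  apply: (cobd_submodule sJ _ sl) => t tl.
  rewrite (_ : _ + _ = contract c g t - cobd h t - y * w t); last by ring.
  exact: wE.
by rewrite !cobdP cobdK; ring.
Qed.

(** Depth sensitivity: a regular sequence of length r in the ideal of the x_j makes
the cohomology vanish in degrees below r. The induction runs along the tails of the
sequence, starting from the empty tail, about which nothing has to be shown. *)
Lemma regular_seq_acyclic (s : seq R) :
  regular_seq s ->
  (forall y, y \in s -> exists c, y = \sum_j c j * x j) ->
  forall l, (l < size s)%N -> acyclic_mod (eq^~ 0) l.
Proof.
move=> [reg _] sx.
pose J i := ideal_gen (fun y => y \in take i s).
have sJ i : submodule (J i).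
  by split=> [|a u v]; [apply: ideal_gen0 | apply: ideal_genP].
suff H r : (r <= size s)%N -> forall l, (l < r)%N -> acyclic_mod (J (size s - r)%N) l.
  move=> l ls g g0.
  have J0 z : J 0%N z <-> z = 0.
    split=> [|->]; last exact: ideal_gen0.
    move=> zJ; pattern z; apply: ideal_gen_elim zJ => //.
      by move=> a u v -> ->; rewrite mulr0 addr0.
    by move=> y; rewrite take0.
  have := H (size s) (leqnn _) l ls g; rewrite subnn => -[t tl|h hE].
    by apply/J0/g0.
  by exists h => t tl; apply/J0/hE.
elim: r => [|r IH] rs // l lr.
set i := (size s - r.+1)%N.
have is_ : (i < size s)%N by rewrite /i -subn_gt0 subKn.
have iS : (size s - r)%N = i.+1 by rewrite /i -subSn.
apply: (@acyclic_span (J i) s`_i r) => //.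
- by apply: sx; apply: mem_nth.
- by move=> z; apply: reg.
move=> m mr g Jg.
have Jsub z : J i.+1 z <-> span s`_i (J i) z.
  rewrite /J (take_nth 0 is_); split; first exact: ideal_gen_rcons.
  move=> [w [a [aJ ->]]]; rewrite addrC mulrC; apply: ideal_genP.
    by apply: ideal_gen1; rewrite mem_rcons mem_head.
  by apply: ideal_gen_incl aJ => y; rewrite mem_rcons inE orbC => ->.
have := IH (ltnW rs) m mr g; rewrite iS => -[t tm|h hE].
  by apply/Jsub; apply: Jg.
by exists h => t tm; apply/Jsub; apply: hE.
Qed.

(** The part of the long exact sequence of multiplication by f that gives
the vanishing of H^k mod f from that of H^k and H^{k+1}. *)
Lemma acyclic_quotient f k :
  (forall z, f * z = 0 -> z = 0) ->
  acyclic_mod (eq^~ 0) k.+1 -> acyclic_mod (eq^~ 0) k ->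
  acyclic_mod (fun z => exists w, z = f * w) k.
Proof.
move=> reg acy1 acy0 g gE.
have {}gE s : exists w, size s = k.+1 -> cobd g s = f * w.
  have [sk|] := EM (size s = k.+1); last by exists 0.
  by have [w ->] := gE _ sk; exists w.
have [w wE] := choice gE.
have sub0 : submodule (eq^~ (0 : R)) by split=> // a u v -> ->; rewrite mulr0 addr0.
have [s sk|u uE] := acy1 w.
  apply: reg.
  rewrite (_ : f * _ = - cobd (fun t => (- f) * w t + cobd g t) s); last first.
    by rewrite cobdP cobdK; ring.
  rewrite (cobd_submodule sub0 _ sk) ?oppr0 // => t tk.
  by rewrite wE //; ring.
have [s sk|v vE] := acy0 (fun t => (- f) * u t + g t).
  have E : w s - cobd u s = 0 by apply: uE.
  rewrite cobdP wE // (_ : _ + _ = f * (w s - cobd u s)); last by ring.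
  by rewrite E mulr0.
exists v => s sk; exists (u s).
by apply/eqP; rewrite -subr_eq0; apply/eqP; rewrite -[RHS](vE s sk); ring.
Qed.

End Koszul.

(** * The Hilbert basis theorem *)

Lemma nondecreasing_subsequence (v : nat -> nat) : exists psi : nat -> nat,
  {homo psi : a b / (a < b)%N} /\ {homo v \o psi : a b / (a <= b)%N}.
Proof.
have /choice[next nextP] N :
    exists m, (N <= m)%N /\ forall k, (N <= k)%N -> (v m <= v k)%N.
  have ex : exists y, `[< exists2 m, (N <= m)%N & y = v m >].
    by exists (v N); apply/asboolP; exists N.
  case: (ex_minnP ex) => _ /asboolP[m Nm ->] minm; exists m; split=> // k Nk.
  by apply: minm; apply/asboolP; exists k.
pose psi := fix psi a := if a is a'.+1 then next (psi a').+1 else next 0%N.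
have psiS a : (psi a < psi a.+1)%N by have [] := nextP (psi a).+1.
have psi_mono : {homo psi : a b / (a < b)%N}.
  by apply: homo_ltn => // x y z; apply: ltn_trans.
exists psi; split=> //; apply: homo_leq => //= [x y z|a]; first exact: leq_trans.
have [N_le vmin] : exists N, psi a = next N by case: a => [|a]; eexists.
by rewrite vmin; have [Nn] := nextP N_le; apply; rewrite (leq_trans Nn) // -vmin ltnW.
Qed.

Lemma dickson n (u : nat -> 'X_{1..n}) :
  exists i j, (i < j)%N /\ (u i <= u j)%MM.
Proof.
have H k : exists phi : nat -> nat, {homo phi : a b / (a < b)%N} /\
    forall i : 'I_n, (i < k)%N -> {homo (fun a => u (phi a) i) : a b / (a <= b)%N}.
  elim: k => [|k [phi [phi_mono uphi]]]; first by exists id; split=> [a b|i].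
  have [kn|nk] := ltnP k n; last first.
    by exists phi; split=> // i _; apply: uphi; apply: leq_trans nk.
  have [psi [psi_mono upsi]] :=
    nondecreasing_subsequence (fun a => u (phi a) (Ordinal kn)).
  exists (phi \o psi); split=> [a b ab|i]; first by apply: phi_mono; apply: psi_mono.
  rewrite ltnS leq_eqVlt => /predU1P[ik|ik] a b ab /=.
    by rewrite (_ : i = Ordinal kn); [exact: (upsi a b ab) | exact: val_inj].
  by apply: uphi => //; apply: (ltnW_homo psi_mono).
have [phi [phi_mono uphi]] := H n.
exists (phi 0%N), (phi 1%N); split; first exact: phi_mono.
by apply/mnm_lepP => i; apply: uphi.
Qed.

Section Hilbert.
Import Order.TTheory.
Variables (K : fieldType) (n : nat).
Local Notation S := {mpoly K[n]}.

Lemma mlead_cancel (p q : S) : q != 0 -> (mlead q <= mlead p)%MM ->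
  exists a, p - a * q = 0 \/ (mlead (p - a * q) < mlead p)%O.
Proof.
move=> q0 qp; set m := (mlead p - mlead q)%MM.
have lc0 : mleadc q != 0 by rewrite mleadc_eq0.
have mE : (m + mlead q)%MM = mlead p by rewrite submK.
pose a : S := (mleadc p / mleadc q) *: 'X_[m].
have aq : (a * q)@_(mlead p) = mleadc p.
  have E : ('X_[m] * q)@_(mlead p) = mleadc q by rewrite -mE mulrC mcoeffMX.
  by rewrite -scalerAl mcoeffZ E divfK.
exists a; have [->|r0] := eqVneq (p - a * q) 0; [by left | right].
rewrite lt_neqAle; apply/andP; split.
  apply: contra r0 => /eqP E; rewrite -mleadc_eq0 E mcoeffB aq subrr.
  by [].
apply: le_trans (mleadB_le _ _) _; rewrite leUx lexx /=.
apply: le_trans (mleadM_le _ _) _; rewrite -mE lemc_add2l.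
by apply: le_trans (mleadZ_le _ _) _; rewrite mleadXm.
Qed.

(** If J were not finitely generated, choose repeatedly an element of J outside the
ideal of the previous ones with leading monomial as small as possible. By Dickson's lemma
one of these leading monomials divides a later one, and cancelling it contradicts
minimality. *)
Lemma hilbert_basis (J : idealr S) : exists gs : seq S,
  {subset gs <= J} /\ forall p, p \in J -> ideal_gen (fun y => y \in gs) p.
Proof.
apply: contrapT => no.
have nextP (gs : seq S) : exists p, {subset gs <= J} ->
    [/\ p \in J, ~ ideal_gen (fun y => y \in gs) p &
      forall q, q \in J -> (mlead q < mlead p)%O -> ideal_gen (fun y => y \in gs) q].
  have [gsJ|] := EM {subset gs <= J}; last by exists 0.
  apply: contrapT => nomin; apply: no; exists gs; split=> // p.
  move: p; suff H m p : mlead p = m -> p \in J -> ideal_gen (fun y => y \in gs) p.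
    by move=> p; apply: H.
  elim/(well_founded_ind (@ltom_wf n)): m p => m IH p pm pJ.
  apply: contrapT => pgs; apply: nomin; exists p => _; split=> // q qJ.
  by rewrite pm => /IH; apply.
have {nextP}[next nextP] := choice nextP.
pose L := fix L k := if k is k'.+1 then next (L k') :: L k' else [::].
have LJ k : {subset L k <= J}.
  elim: k => [|k IH] y //=; rewrite inE => /predU1P[->|/IH //].
  by have [] := nextP _ IH.
have [i [j [ij le_ij]]] := dickson (fun k => mlead (next (L k))).
set p := next (L i) in le_ij; set q := next (L j) in le_ij.
have p0 : p != 0.
  apply/eqP => p0; have [_ + _] := nextP _ (LJ i); apply.
  by rewrite -/p p0; apply: ideal_gen0.
have pL : p \in L j.
  elim: (j) ij => // k IH; rewrite ltnS leq_eqVlt => /predU1P[<-|/IH pk] /=.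
    exact: mem_head.
  by rewrite inE pk orbT.
have [qJ qL minq] := nextP _ (LJ j).
have pJ := LJ _ _ pL.
have [a aE] := mlead_cancel p0 le_ij.
apply: qL; rewrite -/q -(subrK (a * p) q) addrC; apply: ideal_genP.
  exact: ideal_gen1.
have [->|lt_q] := aE; first exact: ideal_gen0.
by apply: minq => //; apply: rpredB => //; apply: idealMr.
Qed.
End Hilbert.

(** * Monomial ideals, monomial primes and edge ideals *)

Section Monomials.
Variables (K : fieldType) (n : nat).
Local Notation S := {mpoly K[n]}.
Implicit Types (J : idealr S) (g : S) (m : 'X_{1..n}).

Lemma ideal_of_msupp J g :
  (forall m, m \in msupp g -> 'X_[m] \in J) -> g \in J.
Proof.
move=> gJ; rewrite (mpolyE g) big_seq; apply: rpred_sum => m mg.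
by rewrite -mul_mpolyC; apply: idealMr; apply: gJ.
Qed.

Lemma monomial_ideal_msupp J g m : monomial_ideal J ->
  g \in J -> m \in msupp g -> 'X_[m] \in J.
Proof.
move=> [N NJ] /NJ gN; pose H g := forall m, m \in msupp g -> 'X_[m] \in J.
suff: H g by apply.
pattern g; apply: ideal_gen_elim gN => [m'|a u v Hu Hv m'|].
- by rewrite msupp0.
- move=> /msuppD_le; rewrite mem_cat => /orP[/msuppM_le|]; last exact: Hv.
  move=> /allpairsP[[m1 m2] /= [_ /Hu m2J ->]].
  by rewrite mpolyXD idealMr.
move=> _ [m' Nm ->] m''; rewrite msuppX inE => /eqP->.
by apply/NJ/ideal_gen1; exists m'.
Qed.

Lemma pihomogM d e (f b : S) : f \is d.-homog ->
  pihomog mdeg e (f * b) = if (d <= e)%N then f * pihomog mdeg (e - d)%N b else 0.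
Proof.
move=> fd; rewrite (mpolyE b) mulr_sumr !raddf_sum /=.
transitivity (\sum_(m <- msupp b)
    if (mdeg m + d == e)%N then b@_m *: (f * 'X_[m]) else 0).
  apply: eq_bigr => m _; rewrite -scalerAr linearZ /=.
  have fm : f * 'X_[m] \is (d + mdeg m).-homog by apply: dhomogM => //; rewrite dhomogX.
  rewrite addnC; case: eqP => [<-|/eqP ne]; first by rewrite pihomog_dE.
  by rewrite (pihomog_ne0 ne) ?scaler0.
have [de|ed] := leqP d e; last first.
  rewrite big1 // => m _; case: eqP => // E.
  by move: ed; rewrite -E ltnNge leq_addl.
rewrite mulr_sumr; apply: eq_bigr => m _; rewrite linearZ /= pihomogX.
rewrite -{1}(subnK de) eqn_add2r; case: eqP => _; first by rewrite scalerAr.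
by rewrite scaler0 mulr0.
Qed.

Section VariablePrime.
Variable W : {set 'I_n}.

Definition avoids m := [forall i in W, m i == 0%N].

(** The substitution whose kernel is the prime generated by the variables in W. *)
Definition kill_point : n.-tuple S := [tuple if i \in W then 0 else 'X_i | i < n].

Local Notation kill := (comp_mpoly kill_point).

Lemma killX m : kill 'X_[m] = if avoids m then 'X_[m] else 0.
Proof.
rewrite comp_mpolyX; case: ifPn => [/forall_inP aW|].
  rewrite mpolyXE_id; apply: eq_bigr => i _; rewrite tnth_mktuple.
  by case: ifP => // /aW /eqP ->; rewrite !expr0.
rewrite negb_forall => /existsP[i]; rewrite negb_imply => /andP[iW mi].
by rewrite (bigD1 i) //= tnth_mktuple iW expr0n (negbTE mi) mul0r.
Qed.

Lemma mcoeff_kill g m : (kill g)@_m = if avoids m then g@_m else 0.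
Proof.
rewrite comp_mpolyEX (raddf_sum (mcoeff m)) /=.
have E m' : (g@_m' *: kill 'X_[m'])@_m = if avoids m then (g@_m' *: 'X_[m'])@_m else 0.
  rewrite killX !mcoeffZ; have [<-|ne] := eqVneq m' m.
    by case: ifP; rewrite ?mcoeff0 ?mulr0.
  have X0 : ('X_[m'] : S)@_m = 0 by rewrite mcoeffX (negbTE ne).
  by do 2![case: ifP => _]; rewrite ?X0 ?mcoeff0 ?mulr0.
rewrite (eq_bigr _ (fun m' _ => E m')); case: ifP => _; last by rewrite big1.
by rewrite [in RHS](mpolyE g) (raddf_sum (mcoeff m)).
Qed.

Definition variable_prime : prime_idealr S := kernel_prime kill.

Lemma in_variable_prime g :
  (g \in variable_prime) = all (fun m => ~~ avoids m) (msupp g).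
Proof.
apply/idP/allP => [/eqP g0 m|gW].
  apply: contraL => am; rewrite mcoeff_msupp negbK.
  by have := mcoeff_kill g m; rewrite am g0 mcoeff0 => <-.
apply/eqP/mpolyP => m; rewrite mcoeff_kill mcoeff0; case: ifP => // am.
by apply/eqP; rewrite mcoeff_eq0; apply: contraL am => /gW.
Qed.

Lemma variable_primeX m : ('X_[m] \in variable_prime) = ~~ avoids m.
Proof. by rewrite in_variable_prime msuppX /= andbT. Qed.

Lemma variable_primeXU i : ('X_i \in variable_prime) = (i \in W).
Proof.
rewrite variable_primeX negb_forall; apply/existsP/idP => [[j]|iW].
  by rewrite negb_imply mnm1E => /andP[jW]; have [->|] := eqVneq i j.
by exists i; rewrite iW mnm1E eqxx.
Qed.

Lemma variable_prime_gen g : g \in variable_prime ->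
  ideal_gen (fun y => y \in [seq 'X_i | i <- enum W]) g.
Proof.
rewrite in_variable_prime => /allP gW; rewrite (mpolyE g) big_seq.
elim/big_ind: _ => [|u v Hu Hv|m /gW]; first exact: ideal_gen0.
  by rewrite -[u]mul1r; apply: ideal_genP.
rewrite negb_forall => /existsP[i]; rewrite negb_imply => /andP[iW mi].
rewrite -(submK (m := U_(i)%MM) (m' := m)) ?lep1mP // mpolyXD scalerAl -[_ * _]addr0.
apply: ideal_genP; last exact: ideal_gen0.
by apply: ideal_gen1; apply/mapP; exists i; rewrite ?mem_enum.
Qed.

Lemma variable_prime_sum g : g \in variable_prime ->
  exists a : 'I_n -> S, g = \sum_j a j * 'X_j.
Proof.
move=> /variable_prime_gen gW; pattern g; apply: ideal_gen_elim gW.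
- by exists (fun=> 0); rewrite big1 // => j _; rewrite mul0r.
- move=> a u v [c ->] [c' ->]; exists (fun j => a * c j + c' j).
  by rewrite mulr_sumr -big_split; apply: eq_bigr => j _; rewrite /= mulrDl mulrA.
- move=> _ /mapP[i _ ->]; exists (fun j => (j == i)%:R).
  rewrite (bigD1 i) //= eqxx mul1r big1 ?addr0 // => j /negbTE ->.
  by rewrite mul0r.
Qed.

Lemma variable_prime_meval g (p : 'I_n -> K) :
  (forall i, i \in W -> p i = 0) -> g \in variable_prime -> g.@[p] = 0.
Proof.
move=> pW /variable_prime_gen gW; pattern g; apply: ideal_gen_elim gW => /=.
- exact: meval0.
- by move=> a u v u0 v0; rewrite mevalD mevalM u0 v0 mulr0 addr0.
- by move=> _ /mapP[i iW ->]; rewrite mevalXU pW // -mem_enum.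
Qed.

End VariablePrime.

Lemma variable_primeS (W W' : {set 'I_n}) :
  W \subset W' -> {subset variable_prime W <= variable_prime W'}.
Proof.
move=> sWW g gW; have {gW} : all (fun m => ~~ avoids W m) (msupp g).
  by rewrite -in_variable_prime.
rewrite in_variable_prime; apply: sub_all => m.
by apply: contra => /forall_inP aW; apply/forall_inP => i /(fintype.subsetP sWW) /aW.
Qed.

Lemma variable_prime_not_sub (W W' : {set 'I_n}) u :
  u \in W' -> u \notin W -> ~ {subset variable_prime W' <= variable_prime W}.
Proof.
move=> uW' uW sub; have uP : 'X_u \in variable_prime W' by rewrite variable_primeXU.
by have := sub _ uP; rewrite variable_primeXU (negbTE uW).
Qed.

Lemma origin_prime g : (g \in variable_prime [set: 'I_n]) = (g@_0%MM == 0).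
Proof.
rewrite in_variable_prime; apply/allP/idP => [g0|g0 m mg].
  rewrite mcoeff_eq0; apply: contraT; rewrite negbK => /g0 /negP[].
  by apply/forall_inP => i _; rewrite mnm0E.
apply/negP => /forall_inP am; move: mg; rewrite mcoeff_msupp.
suff -> : m = 0%MM by rewrite g0.
by apply/mnmP => i; rewrite mnm0E; apply/eqP/am.
Qed.

Lemma origin_maximal : maximal_ideal (variable_prime [set: 'I_n]).
Proof.
move=> J MJ g gJ; rewrite origin_prime; apply: contraT => g0.
suff: (1 : S) \in J by rewrite idealr1.
have -> : 1 = ((g@_0%MM)^-1)%:MP * (g - (g - (g@_0%MM)%:MP)).
  by rewrite opprB addrC subrK -mpolyCM mulVf.
apply: idealMr; apply: rpredB => //; apply: MJ.
by rewrite origin_prime mcoeffB mcoeffC eqxx mulr1 subrr.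
Qed.

Section EdgeIdeal.
Variable e : rel 'I_n.
Hypothesis e_irr : irreflexive e.

Definition has_edge m := [exists i, exists j, [&& e i j, 0 < m i & 0 < m j]]%N.

Lemma has_edgeP m :
  reflect (exists i j, [/\ e i j, 0 < m i & 0 < m j]%N) (has_edge m).
Proof.
apply: (iffP existsP) => [[i /existsP[j /and3P[*]]]|[i [j [*]]]].
  by exists i, j.
by exists i; apply/existsP; exists j; apply/and3P.
Qed.

Lemma has_edge_add m1 m2 : has_edge m2 -> has_edge (m1 + m2)%MM.
Proof.
move=> /has_edgeP[i [j [eij mi mj]]]; apply/has_edgeP; exists i, j.
by rewrite !mnmDE !addn_gt0 mi mj !orbT.
Qed.

Lemma edge_idealX m : ('X_[m] \in edge_ideal K e) = has_edge m.
Proof.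
apply/idP/idP => [/asboolP|/has_edgeP[i [j [eij mi mj]]]]; last first.
  have ij : i != j by apply: contraTneq eij => ->; rewrite e_irr.
  have le_m : (U_(i) + U_(j) <= m)%MM.
    apply/mnm_lepP => k; rewrite mnmDE !mnm1E.
    have [<-|_] := eqVneq i k; first by rewrite eq_sym (negbTE ij).
    by have [<-|_] := eqVneq j k.
  rewrite -(submK le_m) mpolyXD; apply: idealMr; apply/asboolP.
  by apply: ideal_gen1; exists i, j; rewrite mpolyXD.
move=> H; suff: {in msupp ('X_[m] : S), forall k, has_edge k}.
  by apply; rewrite msuppX inE.
pattern ('X_[m] : S); apply: ideal_gen_elim H => [k|a u v Hu Hv k|].
- by rewrite msupp0.
- move=> /msuppD_le; rewrite mem_cat => /orP[/msuppM_le|]; last exact: Hv.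
  by move=> /allpairsP[[m1 m2] /= [_ /Hu m2J ->]]; apply: has_edge_add.
move=> _ [i [j [eij ->]]] k; rewrite -mpolyXD msuppX inE => /eqP ->.
by apply/has_edgeP; exists i, j; rewrite !mnmDE !mnm1E !eqxx addn1 add1n.
Qed.

Lemma edge_ideal_monomial : monomial_ideal (edge_ideal K e).
Proof.
exists (fun m => exists i j, e i j /\ m = (U_(i) + U_(j))%MM) => g; split.
  move=> /asboolP; apply: ideal_gen_incl => _ [i [j [eij ->]]].
  by exists (U_(i) + U_(j))%MM; [exists i, j | rewrite mpolyXD].
apply: ideal_gen_sub => _ [_ [i [j [eij ->]]] ->].
apply/asboolP/ideal_gen1; exists i, j; by rewrite mpolyXD.
Qed.

Lemma edge_idealP g : reflect {in msupp g, forall m, has_edge m} (g \in edge_ideal K e).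
Proof.
apply: (iffP idP) => [gI m mg|H].
  by rewrite -edge_idealX; apply: monomial_ideal_msupp edge_ideal_monomial gI mg.
by apply: ideal_of_msupp => m /H; rewrite edge_idealX.
Qed.

Lemma edge_ideal_prime (W : {set 'I_n}) :
  (forall i j, e i j -> (i \in W) || (j \in W)) ->
  {subset edge_ideal K e <= variable_prime W}.
Proof.
move=> cover g /edge_idealP H; rewrite in_variable_prime; apply/allP => m /H.
move=> /has_edgeP[i [j [eij mi mj]]]; rewrite negb_forall; apply/existsP.
by case/orP: (cover _ _ eij) => W_; [exists i | exists j];
  rewrite W_ /= -lt0n.
Qed.

End EdgeIdeal.
End Monomials.

(** * Localizing a quotient ring *)

Section Localization.
Local Open Scope quotient_scope.
Variables (S : comNzRingType) (A : idealr S) (M : prime_idealr S).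
Hypothesis AM : {subset A <= M}.
Local Notation R := {ideal_quot A}.

Definition quot_map (p : S) : R := \pi_R p.

Lemma quot_map_zmod : zmod_morphism quot_map.
Proof. by move=> p q; rewrite /quot_map rmorphB. Qed.

Lemma quot_map_monoid : monoid_morphism quot_map.
Proof. by split=> [|p q]; rewrite /quot_map ?rmorph1 ?rmorphM. Qed.

HB.instance Definition _ := GRing.isZmodMorphism.Build S R quot_map quot_map_zmod.
HB.instance Definition _ := GRing.isMonoidMorphism.Build S R quot_map quot_map_monoid.

Lemma quot_mapK r : quot_map (repr r) = r. Proof. exact: reprK. Qed.

Lemma quot_map_eq0 p : (quot_map p == 0) = (p \in A).
Proof.
by rewrite -(rmorph0 quot_map) /quot_map -Quotient.idealrBE subr0.
Qed.

Section QuotientPrime.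
Variable (Q : prime_idealr S).
Hypothesis AQ : {subset A <= Q}.

Definition quot_prime_pred : {pred R} := fun r => repr r \in Q.

Lemma quot_prime_pi p : (quot_map p \in quot_prime_pred) = (p \in Q).
Proof.
have dQ : repr (\pi_R p) - p \in Q.
  by apply: AQ; rewrite Quotient.idealrBE reprK.
rewrite (_ : (_ \in _) = (repr (\pi_R p) \in Q)) //.
by rewrite -[repr _](subrK p) rpredDl.
Qed.

Lemma quot_prime_idealr_closed : idealr_closed quot_prime_pred.
Proof.
split; first by rewrite -(rmorph0 quot_map) quot_prime_pi rpred0.
  by rewrite -(rmorph1 quot_map) quot_prime_pi idealr1.
move=> a u v; rewrite -[a]quot_mapK -[u]quot_mapK -[v]quot_mapK -rmorphM -rmorphD.
by rewrite !quot_prime_pi => uQ vQ; apply: rpredD => //; apply: idealMr.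
Qed.

Lemma quot_prime_prime_closed : prime_idealr_closed quot_prime_pred.
Proof.
move=> u v; rewrite -[u]quot_mapK -[v]quot_mapK -rmorphM !quot_prime_pi.
by rewrite prime_idealrM.
Qed.

Definition quot_prime : prime_idealr R :=
  mk_prime quot_prime_idealr_closed quot_prime_prime_closed.

Lemma in_quot_prime p : (quot_map p \in quot_prime) = (p \in Q).
Proof. exact: quot_prime_pi. Qed.

End QuotientPrime.

Definition MR : prime_idealr R := quot_prime AM.
Local Notation L := (localization MR).

Lemma in_MR p : (quot_map p \in MR) = (p \in M).
Proof. exact: in_quot_prime. Qed.

Definition loc_map (p : S) : L := \pi_L (quot_map p, denom1 MR).

Lemma loc_map_zmod : zmod_morphism loc_map.
Proof.
move=> p q; change (loc_map (p - q) = loc_add (loc_map p) (loc_opp (loc_map q))).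
by rewrite /loc_map loc_oppE loc_addE; apply: loc_eq1 => /=; rewrite rmorphB !mulr1.
Qed.

Lemma loc_map_monoid : monoid_morphism loc_map.
Proof.
split; first by rewrite /loc_map rmorph1.
move=> p q; change (loc_map (p * q) = loc_mul (loc_map p) (loc_map q)).
by rewrite /loc_map loc_mulE; apply: loc_eq1 => /=; rewrite rmorphM !mulr1.
Qed.

HB.instance Definition _ := GRing.isZmodMorphism.Build S L loc_map loc_map_zmod.
HB.instance Definition _ := GRing.isMonoidMorphism.Build S L loc_map loc_map_monoid.

Lemma loc_map_eq0 p : loc_map p = 0 -> exists2 w, w \notin M & w * p \in A.
Proof.
change (loc_map p = \pi_L (frac_zero MR) -> exists2 w, w \notin M & w * p \in A).
move=> /loc_eqP[w wM /= E].
exists (repr w); first by rewrite -in_MR quot_mapK.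
rewrite -quot_map_eq0 rmorphM [X in X * _]quot_mapK.
by move: E; rewrite mulr1 mul0r subr0 => ->.
Qed.

Lemma loc_map0 p : p \in A -> loc_map p = 0.
Proof.
by rewrite -quot_map_eq0 /loc_map => /eqP->.
Qed.

Definition mk_denom r (rM : r \notin MR) : denom MR :=
  @exist R (fun r => is_true (r \notin MR)) r rM.

Lemma loc_map_unit s : s \notin M -> exists u, u * loc_map s = 1.
Proof.
rewrite -in_MR => sM; exists (\pi_L (1, mk_denom sM)).
change (loc_mul (\pi_L (1, mk_denom sM)) (loc_map s) = \pi_L (frac_one MR)).
by rewrite loc_mulE; apply: loc_eq1 => /=; ring.
Qed.

Lemma loc_denominator (l : L) : exists s p, s \notin M /\ loc_map s * l = loc_map p.
Proof.
elim/loc_ind: l => -[r [s sM]].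
exists (repr s), (repr r); split; first by rewrite -in_MR quot_mapK.
change (loc_mul (loc_map (repr s)) (\pi_L (r, mk_denom sM)) = loc_map (repr r)).
rewrite loc_mulE; apply: loc_eq1 => /=.
by rewrite !quot_mapK; ring.
Qed.

(** A denominator s is invertible, so a numerator p outside M would make l a unit. *)
Lemma loc_proper (J : idealr L) l s p :
  l \in J -> loc_map s * l = loc_map p -> p \in M.
Proof.
move=> lJ E; apply: contraT => /loc_map_unit[u u1].
by have := idealr1 J; rewrite -u1 -E !idealMr.
Qed.

Section ExtendedPrime.
Variable (Q : prime_idealr S).
Hypotheses (AQ : {subset A <= Q}) (QM : {subset Q <= M}).

(** The extension of Q to the localization. Requiring some numerator in Q is the same
as requiring all of them to be in Q ([loc_primeE]), which makes it easy to compute. *)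
Definition loc_prime_pred : {pred L} :=
  fun l => `[< exists s p, [/\ s \notin M, loc_map s * l = loc_map p & p \in Q] >].

Lemma loc_primeE l s p : s \notin M -> loc_map s * l = loc_map p ->
  (l \in loc_prime_pred) = (p \in Q).
Proof.
move=> sM E; apply/asboolP/idP => [[t [q [tM F qQ]]]|pQ]; last by exists s, p.
have : loc_map (s * q - t * p) = 0.
  by rewrite rmorphB !rmorphM /= -E -F; ring.
move=> /loc_map_eq0[w wM /AQ]; rewrite prime_idealrM => /orP[/QM|H].
  by rewrite (negbTE wM).
have : t * p \in Q.
  by rewrite -[t * p](subKr (s * q)) rpredB // idealMr.
by rewrite prime_idealrM => /orP[/QM|//]; rewrite (negbTE tM).
Qed.

Lemma loc_prime_map p : (loc_map p \in loc_prime_pred) = (p \in Q).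
Proof.
by apply: (@loc_primeE _ 1); rewrite ?idealr1 // rmorph1 mul1r.
Qed.

Lemma loc_prime_idealr_closed : idealr_closed loc_prime_pred.
Proof.
split; first by rewrite -(rmorph0 loc_map) loc_prime_map rpred0.
  by rewrite -(rmorph1 loc_map) loc_prime_map idealr1.
move=> a u v.
have [r [a' [rM aE]]] := loc_denominator a.
have [s [u' [sM uE]]] := loc_denominator u.
have [t [v' [tM vE]]] := loc_denominator v.
rewrite (loc_primeE sM uE) (loc_primeE tM vE) => uQ vQ.
rewrite (@loc_primeE _ (r * s * t) (t * (a' * u') + r * s * v')).
- by apply: rpredD; rewrite ?idealMr.
- by rewrite !prime_idealrM !negb_or rM sM.
- by rewrite rmorphD !rmorphM /= -aE -uE -vE; ring.
Qed.

Lemma loc_prime_prime_closed : prime_idealr_closed loc_prime_pred.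
Proof.
move=> u v.
have [s [u' [sM uE]]] := loc_denominator u.
have [t [v' [tM vE]]] := loc_denominator v.
rewrite (loc_primeE sM uE) (loc_primeE tM vE) -prime_idealrM.
rewrite (@loc_primeE _ (s * t) (u' * v')) //; first by rewrite prime_idealrM negb_or sM.
by rewrite !rmorphM /= -uE -vE; ring.
Qed.

Definition loc_prime : prime_idealr L :=
  mk_prime loc_prime_idealr_closed loc_prime_prime_closed.

Lemma in_loc_prime l s p : s \notin M -> loc_map s * l = loc_map p ->
  (l \in loc_prime) = (p \in Q).
Proof. exact: loc_primeE. Qed.

Lemma in_loc_prime_map p : (loc_map p \in loc_prime) = (p \in Q).
Proof. exact: loc_prime_map. Qed.

End ExtendedPrime.

Lemma loc_prime_chain (c : nat -> prime_idealr S) k :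
  (forall i, {subset A <= c i} /\ {subset c i <= M}) ->
  prime_chain c k -> exists c' : nat -> prime_idealr L, prime_chain c' k.
Proof.
move=> cM ck; exists (fun i => loc_prime (cM i).1 (cM i).2) => i ik.
have [sub nsub] := ck i ik; split=> [l|sub'].
  have [s [p [sM E]]] := loc_denominator l.
  by rewrite !(in_loc_prime _ _ sM E) => /sub.
by apply: nsub => p; rewrite -(in_loc_prime_map (cM i.+1).1 (cM i.+1).2)
  -(in_loc_prime_map (cM i).1 (cM i).2) => /sub'.
Qed.

(** The depth of the localization at M is its dimension, and its dimension is at least
k because the primes between A and M extend to the localization. *)
Lemma CM_localization k (c : nat -> prime_idealr S) :
  CohenMacaulay R -> maximal_ideal M ->
  (forall i, {subset A <= c i} /\ {subset c i <= M}) -> prime_chain c k ->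
  exists s : seq L, [/\ (k <= size s)%N, regular_seq s &
    forall y, y \in s -> exists t p,
      [/\ t \notin M, p \in M & loc_map t * y = loc_map p]].
Proof.
move=> CM maxM cM ck.
have maxMR : maximal_ideal MR.
  move=> J MJ r; rewrite -[r]quot_mapK => rJ; rewrite in_MR.
  pose JS : {pred S} := fun p => quot_map p \in J.
  have JSE p : (p \in JS) = (quot_map p \in J) by [].
  have JS_closed : idealr_closed JS.
    split; rewrite ?JSE ?rmorph0 ?rmorph1 ?rpred0 ?idealr1 // => a u v.
    by rewrite !JSE rmorphD rmorphM => uJ vJ; rewrite rpredD // idealMr.
  apply: (maxM (mk_ideal JS_closed)) => // p pM.
  by change (p \in JS); rewrite JSE; apply: MJ; rewrite in_MR.
have [N [locN [d [[Cd nCd] [[s [sd sN reg]] _]]]]] := CM _ maxMR.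
exists s; split=> // [|y ys].
  rewrite sd leqNgt; apply/negP => dk; apply: nCd.
  have [c' c'k] := loc_prime_chain cM ck.
  by exists c' => i id; apply: c'k; apply: leq_trans dk.
have [t [p [tM E]]] := loc_denominator y.
by exists t, p; split=> //; apply: (loc_proper (sN _ ys) E).
Qed.

Lemma common_multiple (I : finType) (D : I -> S -> Prop) :
  (forall i q r, D i q -> D i (r * q)) -> (forall i, exists2 q, q \notin M & D i q) ->
  exists2 q, q \notin M & forall i, D i q.
Proof.
move=> DM Dex.
have [q qM Dq] : exists2 q, q \notin M & forall i, i \in enum I -> D i q.
  elim: (enum I) => [|i s [q qM IH]]; first by exists 1; rewrite ?idealr1.
  have [r rM Dr] := Dex i; exists (q * r); first by rewrite prime_idealrM negb_or qM.
  move=> j; rewrite inE => /predU1P[->|/IH]; first exact: DM.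
  by rewrite mulrC; apply: DM.
by exists q => // i; apply: Dq; rewrite mem_enum.
Qed.

Lemma cobd_loc_map n (x : 'I_n -> S) (g : seq 'I_n -> S) s :
  loc_map (cobd x g s) = cobd (loc_map \o x) (loc_map \o g) s.
Proof.
elim: s g => [|i s IH] g; first by rewrite /= rmorph0.
by rewrite /= rmorphB rmorphM /= IH.
Qed.

(** The cohomological consequence of the Cohen-Macaulay property, with denominators
cleared: a cocycle of degree m modulo (A, f) becomes a coboundary modulo (A, f) after
multiplication by some q outside M, as soon as m + 1 is less than the length of a chain of
primes between A and M. *)
Lemma CM_cocycle n (x : 'I_n -> S) k (c : nat -> prime_idealr S) f g m :
  CohenMacaulay R -> maximal_ideal M ->
  (forall i, {subset A <= c i} /\ {subset c i <= M}) -> prime_chain c k ->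
  (forall p, p \in M -> exists a, p = \sum_j a j * x j) ->
  (forall p, f * p \in A -> p \in A) -> (m.+1 < k)%N ->
  (forall s, size s = m.+1 -> exists w, cobd x g s - f * w \in A) ->
  exists2 q, q \notin M & exists h, forall s, size s = m ->
    exists w, q * g s - cobd x h s - f * w \in A.
Proof.
move=> CM maxM cM ck xM fA mk gA.
have [s [ks reg sM]] := CM_localization CM maxM cM ck.
pose X : 'I_n -> L := loc_map \o x.
have acy l : (l < k)%N -> acyclic_mod X (eq^~ 0) l.
  move=> lk; apply: (regular_seq_acyclic reg); last exact: leq_trans ks.
  move=> y /sM[t [p [tM /xM[a ->] E]]].
  have [u uE] := loc_map_unit tM.
  exists (fun j => u * loc_map (a j)).
  rewrite -[y]mul1r -uE -mulrA E rmorph_sum mulr_sumr.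
  by apply: eq_bigr => j _; rewrite rmorphM mulrA.
have freg z : loc_map f * z = 0 -> z = 0.
  have [t [p [tM E]]] := loc_denominator z => fz.
  have /loc_map_eq0[w wM] : loc_map (f * p) = 0.
    by rewrite rmorphM /= -E mulrCA fz mulr0.
  rewrite mulrCA => /fA /loc_map0; rewrite rmorphM /= -E.
  have [u uE] := loc_map_unit wM; have [v vE] := loc_map_unit tM.
  move=> /(congr1 ( *%R (u * v))).
  rewrite mulr0 => <-; rewrite -[LHS]mul1r -[in LHS]uE -[in LHS](mulr1 (u * _)) -vE.
  by rewrite /=; ring.
have [s' s'm|H hE] :=
    acyclic_quotient freg (acy _ mk) (acy _ (ltnW mk)) (g := loc_map \o g).
  have [w /loc_map0 /eqP] := gA _ s'm.
  by rewrite rmorphB rmorphM /= subr_eq0 cobd_loc_map => /eqP E; exists (loc_map w).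
(* Clear the denominators of H, and then those of the cofactors of f. *)
have [t tM /choice[h0 h0E]] : exists2 t, t \notin M & forall v : m.-1.-tuple 'I_n,
    exists p, loc_map t * H v = loc_map p.
  apply: common_multiple => [v q r [p E]|v].
    by exists (r * p); rewrite !rmorphM /= -E mulrA.
  by have [q [p [qM E]]] := loc_denominator (H v); exists q => //; exists p.
pose h (s : seq 'I_n) : S := if insub s is Some v then h0 v else 0.
have hH s' : size s' = m -> cobd X (loc_map \o h) s' = loc_map t * cobd X H s'.
  move=> s'm; rewrite -[RHS]addr0 -(_ : cobd X (fun=> 0) s' = 0).
    rewrite -cobdP; apply: eq_cobd_size => u; rewrite s'm => /eqP um.
    by rewrite /= /h (insubT (fun u => size u == m.-1) um) addr0 -h0E.
  by elim: (s') => //= j u ->; rewrite mulr0 subr0.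
have [q qM qE] : exists2 q, q \notin M & forall v : m.-tuple 'I_n,
    exists w, q * (t * g v - cobd x h v) - f * w \in A.
  apply: common_multiple => [v q r [w wA]|v].
    exists (r * w); have -> : r * q * (t * g v - cobd x h v) - f * (r * w) =
      r * (q * (t * g v - cobd x h v) - f * w) by ring.
    exact: idealMr.
  have [w wE] := hE v (size_tuple v).
  have [r [p [rM rE]]] := loc_denominator (loc_map t * w).
  have /loc_map_eq0[r' r'M r'A] : loc_map (r * (t * g v - cobd x h v) - f * p) = 0.
    rewrite rmorphB !rmorphM rmorphB rmorphM /= -rE cobd_loc_map hH ?size_tuple //.
    have -> : loc_map (g v) = loc_map f * w + cobd X H v by rewrite -wE /= subrK.
    by ring.
  exists (r' * r); first by rewrite prime_idealrM negb_or r'M.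
  exists (r' * p); have -> : r' * r * (t * g v - cobd x h v) - f * (r' * p) =
    r' * (r * (t * g v - cobd x h v) - f * p) by ring.
  by [].
exists (q * t); first by rewrite prime_idealrM negb_or qM.
exists (fun u => q * h u + 0) => s' /eqP s'm; have [w wA] := qE (Tuple s'm).
exists w; rewrite cobdP (_ : cobd x (fun=> 0) s' = 0); last first.
  by elim: (s') => //= j u ->; rewrite mulr0 subr0.
by rewrite addr0 -mulrA -mulrBr.
Qed.

End Localization.

(** * Basic double links of edge ideals *)

Section Heights.
Variables (K : fieldType) (n : nat).
Local Notation S := {mpoly K[n]}.
Implicit Types (A B : idealr S) (P Q : prime_idealr S).

Lemma prime_chain_suffix (c : nat -> prime_idealr S) k l :
  (l <= k)%N -> prime_chain c k ->
  exists c' : nat -> prime_idealr S, prime_chain c' l /\ c' l = c k.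
Proof.
move=> lk ck; exists (fun i => c (i + (k - l))%N); rewrite subnKC //; split=> // i il.
by rewrite addSn; apply: ck; rewrite addnC -ltn_subRL subKn.
Qed.

Lemma prime_height_le P h k : prime_height P h -> prime_height P k -> (k <= h)%N.
Proof.
move=> [_ nh] [[c [ck cP]] _]; rewrite leqNgt; apply/negP => hk; apply: nh.
by have [c' [c'h E]] := prime_chain_suffix hk ck; exists c'; rewrite E.
Qed.

(** A smaller prime between A and P would have a height, and one less than h. *)
Lemma height_minimal A P h : {subset A <= P} -> prime_height P h ->
  (forall Q k, {subset A <= Q} -> prime_height Q k -> (h <= k)%N) ->
  forall Q, {subset A <= Q} -> {subset Q <= P} -> {subset P <= Q}.
Proof.
move=> AP [_ nh] minh Q AQ QP; apply: contrapT => PQ.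
pose C k := exists c, prime_chain c k /\ c k =i Q.
have nC : ~ C h.
  move=> [c [ch cQ]]; apply: nh.
  exists (fun i => if (i <= h)%N then c i else P); split=> [i|]; last by rewrite ltnn.
  rewrite ltnS => ih; rewrite ih; case: ltnP => [/ch//|hi].
  have -> : i = h by apply/eqP; rewrite eqn_leq ih.
  by split=> [y|PQ']; [rewrite cQ => /QP | apply: PQ => y /PQ'; rewrite cQ].
have [k kh [Ck nCk]] : exists2 k, (k < h)%N & C k /\ ~ C k.+1.
  elim: (h) nC => [[]|k IH nC]; first by exists (fun=> Q).
  by have [Ck|/IH[l lk Cl]] := EM (C k); [exists k | exists l => //; apply: ltnW].
by have := minh Q k AQ (conj Ck nCk); rewrite leqNgt kh.
Qed.

(** An associated prime P of A has the height of every associated prime of A, among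
which are those that realize the height of A; a prime containing B is higher. *)
Lemma unmixed_height_gap A B P h : unmixed A ->
  ideal_height A h -> ideal_height B h.+1 ->
  associated_prime A P -> ~ {subset B <= P}.
Proof.
move=> [k Ak] [[P0 [AP0 P0h]] minh] [_ minB] AP BP.
have hk := minB P k BP (Ak _ AP).
have [ps [psP0 genP0]] := hilbert_basis P0.
have P0A : associated_prime A P0.
  exact: (minimal_over_associated AP0 (height_minimal AP0 P0h minh) psP0 genP0).
by have := prime_height_le P0h (Ak _ P0A); rewrite leqNgt hk.
Qed.

End Heights.

Section Link.
Variables (K : fieldType) (n : nat) (e : rel 'I_n).
Hypotheses (e_irr : irreflexive e) (e_sym : ssrbool.symmetric e).
Local Notation S := {mpoly K[n]}.
Local Notation I := (edge_ideal K e).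
Variables (d : nat) (f : S) (A B : idealr S).
Hypotheses (monB : monomial_ideal B) (GL : basic_double_Glink d f A B I).

Lemma link_nonzerodivisor p : f * p \in A -> p \in A.
Proof. by move=> fp; rewrite -(bdl_colon GL). Qed.

Lemma link_subA : {subset A <= I}.
Proof.
move=> a aA; apply/(bdl_eq GL); exists a, 0; rewrite rpred0 mulr0 add0r.
by split.
Qed.

Lemma link_mulB b : b \in B -> f * b \in I.
Proof.
move=> bB; apply/(bdl_eq GL); exists 0, b; rewrite rpred0 addr0.
by split.
Qed.

(** Otherwise I = A, so f B is in A, so B = A, against the heights. *)
Lemma link_edge_notin : exists i j, e i j /\ 'X_i * 'X_j \notin A.
Proof.
apply: contrapT => no.
have IA : {subset I <= A}.
  move=> g /asboolP; apply: ideal_gen_sub => _ [i [j [eij ->]]].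
  by apply: contrapT => /negP nA; apply: no; exists i, j.
have BA : {subset B <= A} by move=> b /link_mulB /IA /link_nonzerodivisor.
have [h [[[P [AP Ph]] _] [_ minB]]] := bdl_height GL.
have := minB P h _ Ph; rewrite ltnn => H; suff: false by []; apply: H.
by move=> b /BA /AP.
Qed.

(** In degree 2, an edge outside A is f times an element of B of degree 2 - d plus
an element of A; since B is proper, this degree is positive. *)
Lemma link_linear : d = 1%N /\ exists v, 'X_v \in B.
Proof.
have [i [j [eij ijA]]] := link_edge_notin.
have ijI : 'X_i * 'X_j \in I by apply/asboolP/ideal_gen1; exists i, j.
have [a [b [aA bB E]]] := (bdl_eq GL _).1 ijI.
have [hA hB _] := bdl_homogeneous GL; have [d0 fd] := bdl_degree GL.
have ij2 : ('X_i * 'X_j : S) \is 2.-homog.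
  by rewrite -mpolyXD dhomogX /= mdegD !mdeg1.
have {E} E : 'X_i * 'X_j = pihomog mdeg 2 (f * b) + pihomog mdeg 2 a.
  by rewrite -pihomogD -E pihomog_dE.
have := ijA; rewrite E (pihomogM _ _ fd); case: ifP => [d2|_]; last first.
  by rewrite add0r hA.
set b' := pihomog _ _ b => fb'.
have b'0 : b' != 0.
  by apply: contraNneq fb' => ->; rewrite mulr0 add0r hA.
have [m mb'] : exists m, m \in msupp b'.
  by exists (mlead b'); apply: mlead_supp.
have mB : 'X_[m] \in B by apply: (monomial_ideal_msupp monB (hB b (2 - d)%N bB) mb').
have m0 : m != 0%MM by apply: contraTneq mB => ->; rewrite mpolyX0 idealr1.
have md : mdeg m = (2 - d)%N.
  exact: (dhomog_mf (pihomogP mdeg (2 - d)%N b) mb').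
have d1 : d = 1%N.
  move: m0; rewrite -mdeg_eq0 md subn_eq0 -ltnNge ltnS => d1.
  by apply/eqP; rewrite eqn_leq d1.
split=> //; move: md; rewrite d1 => /eqP/mdeg1P[v /eqP mv].
by exists v; rewrite -mv.
Qed.

Lemma link_form : f = \sum_i f@_U_(i) *: 'X_i.
Proof.
have [d1 _] := link_linear; have [_ fd] := bdl_degree GL; rewrite d1 in fd.
apply/mpolyP => m; rewrite raddf_sum /=.
have [m1|m1] := eqVneq (mdeg m) 1%N.
  have /mdeg1P[i /eqP->] : mdeg m == 1%N by rewrite m1.
  rewrite (bigD1 i) //= mcoeffZ mcoeffXU eqxx mulr1 big1 ?addr0 // => j ji.
  by rewrite mcoeffZ mcoeffXU (negbTE ji) mulr0.
rewrite (dhomog_nemf_coeff fd m1) big1 // => i _.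
rewrite mcoeffZ mcoeffX; case: eqP => [im|]; last by rewrite mulr0.
by move: m1; rewrite -im mdeg1.
Qed.

Lemma link_meval p : f.@[p] = \sum_i f@_U_(i) * p i.
Proof.
rewrite {1}link_form raddf_sum; apply: eq_bigr => i _ /=.
by rewrite mevalZ mevalXU.
Qed.

Lemma link_support : exists t, f@_U_(t) != 0.
Proof.
apply: contrapT => no; have f0 : f = 0.
  rewrite link_form big1 // => i _; have [->|fi] := eqVneq (f@_U_(i)) 0.
    by rewrite scale0r.
  by case: no; exists i.
have := idealr1 A; rewrite (link_nonzerodivisor (p := 1)) // f0 mul0r.
exact: rpred0.
Qed.

Lemma link_support_edge m t :
  'X_[m] \in B -> f@_U_(t) != 0 -> has_edge e (U_(t) + m)%MM.
Proof.
move=> /link_mulB /(edge_idealP e_irr) H ft; apply: H.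
by rewrite mcoeff_msupp addmC mcoeffMX.
Qed.

Lemma link_neighbour t v : 'X_v \in B -> f@_U_(t) != 0 -> e t v.
Proof.
move=> vB /(link_support_edge vB) /has_edgeP[i [j [eij]]].
rewrite !mnmDE !mnm1E => i0 j0.
have ij : i != j by apply: contraTneq eij => ->; rewrite e_irr.
have [ti|ti] := eqVneq t i; have [tj|tj] := eqVneq t j.
- by move: ij; rewrite -ti tj eqxx.
- move: j0; rewrite (negbTE tj) add0n; have [vj|//] := eqVneq v j => _.
  by rewrite vj ti.
- move: i0; rewrite (negbTE ti) add0n; have [vi|//] := eqVneq v i => _.
  by rewrite vi tj e_sym.
move: i0 j0; rewrite (negbTE ti) (negbTE tj) !add0n.
have [vi|//] := eqVneq v i; have [vj|//] := eqVneq v j.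
by move: ij; rewrite -vi vj eqxx.
Qed.

Definition independent (F : {set 'I_n}) := [forall i in F, forall j in F, ~~ e i j].

Lemma independentP (F : {set 'I_n}) :
  reflect {in F &, forall i j, ~~ e i j} (independent F).
Proof.
apply: (iffP forall_inP) => H i; first by move=> j iF; apply: (forall_inP (H i iF)).
by move=> iF; apply/forall_inP => j; apply: H.
Qed.

Lemma facet_exists (F0 : {set 'I_n}) : independent F0 -> exists F : {set 'I_n},
  [/\ F0 \subset F, independent F & forall j, j \notin F -> exists2 k, k \in F & e k j].
Proof.
move=> iF0; have [F /maxsetP[iF maxF] F0F] := maxset_exists iF0.
exists F; split=> // j jF; apply: contrapT => no.
have nk k : k \in F -> ~~ e k j by move=> kF; apply/negP => kj; apply: no; exists k.
suff jFi : independent (j |: F).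
  by move: jF; rewrite -(maxF _ jFi (subsetUr _ _)) setU11.
apply/independentP => a b; rewrite !in_setU1 => /predU1P[->|aF] /predU1P[->|bF].
- by rewrite e_irr.
- by rewrite e_sym nk.
- exact: nk.
- by apply: (independentP _ iF).
Qed.

(** The point p lies on the component of F of the variety of I and on f = 0. Near p the
hypothesis on s says that B equals I, so I = A + f I, so I = A near p by Nakayama's lemma.
Thus the prime of this component is associated to A, although its height is that of B. *)
Lemma link_obstruction (s : 'X_{1..n}) (p : 'I_n -> K) (F : {set 'I_n}) :
  independent F -> (forall j, j \notin F -> exists2 k, k \in F & e k j) ->
  (exists2 t, t \in F & f@_U_(t) != 0) ->
  (forall i, i \notin F -> p i = 0) -> f.@[p] = 0 -> 'X_[s].@[p] != 0 ->
  (forall m, 'X_[m] \in B -> has_edge e (s + m)%MM) -> False.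
Proof.
move=> iF maxF [t tF ft] pF fp sp sB.
pose N := #|{: 'I_n * 'I_n}|.
pose gen (k : 'I_N) : S := let: (i, j) := enum_val k in
  if e i j then 'X_i * 'X_j else 0.
have genI k : gen k \in I.
  rewrite /gen; case: (enum_val k) => i j; case: ifP => [eij|_]; last exact: rpred0.
  by apply/asboolP/ideal_gen1; exists i, j.
have Igen g : g \in I -> exists c : 'I_N -> S, g = \sum_k c k * gen k.
  move=> /asboolP gI; pattern g; apply: ideal_gen_elim gI.
  - by exists (fun=> 0); rewrite big1 // => k _; rewrite mul0r.
  - move=> a u v [c ->] [c' ->]; exists (fun k => a * c k + c' k).
    by rewrite mulr_sumr -big_split; apply: eq_bigr => k _; rewrite /= mulrDl mulrA.
  - move=> _ [i [j [eij ->]]]; exists (fun k => (k == enum_rank (i, j))%:R).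
    rewrite (bigD1 (enum_rank (i, j))) //= eqxx mul1r big1 ?addr0 => [|k /negbTE ->].
      by rewrite /gen enum_rankK eij.
    by rewrite mul0r.
have sBI b : b \in B -> 'X_[s] * b \in I.
  move=> bB; apply/(edge_idealP e_irr) => m; rewrite mulrC => /msuppM_le.
  move=> /allpairsP[[m1 m2] /= [m1b]]; rewrite msuppX inE => /eqP-> ->.
  by rewrite addmC; apply: sB; apply: monomial_ideal_msupp bB m1b.
have [k|u [up uI]] := @determinant_trick S K (meval p) N gen A f 'X_[s] fp.
  have [a [b [aA bB ->]]] := (bdl_eq GL _).1 (genI k).
  have [c cE] := Igen _ (sBI _ bB).
  exists ('X_[s] * a); first exact: idealMr.
  by exists c; rewrite -cE; ring.
have {}uI g : g \in I -> u * g \in A.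
  move=> /Igen[c ->]; rewrite mulr_sumr; apply: rpred_sum => k _.
  by rewrite mulrCA idealMr.
pose P := variable_prime K (~: F).
have IP : {subset I <= P}.
  apply: edge_ideal_prime => // i j eij; rewrite !inE -negb_and.
  by apply: contraL eij => /andP[iF' jF']; apply: (independentP _ iF).
have uP : u \notin P.
  apply/negP => /(variable_prime_meval (p := p)) H; move: sp.
  have : u.@[p] = 0 by apply: H => i; rewrite inE; apply: pF.
  by rewrite up => /eqP; rewrite expf_eq0 => /andP[_ ->].
pose mF : 'X_{1..n} := [multinom (i \in F : nat) | i < n].
have FP : 'X_[mF] \notin P.
  rewrite variable_primeX negbK; apply/forall_inP => i; rewrite inE mnmE.
  by move=> /negbTE ->.
have [unA _] := bdl_unmixed GL.
have [h [hA hB]] := bdl_height GL.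
have AP : associated_prime A P.
  exists (u * 'X_[mF]) => y; apply/idP/idP; rewrite inE /= => yP.
    pattern y; apply: ideal_gen_elim (variable_prime_gen yP).
    - by rewrite mulr0 rpred0.
    - by move=> a v w vA wA; rewrite mulrDr mulrCA rpredD // idealMr.
    - move=> g /mapP[j jF ->]; move: jF; rewrite mem_enum inE => jF.
      rewrite -mulrA; apply: (uI (_ * _)); rewrite -mpolyXD edge_idealX //.
      have [k kF ekj] := maxF j jF; apply/has_edgeP; exists k, j; split=> //.
        by rewrite mnmDE mnmE kF.
      by rewrite mnmDE mnm1E eqxx addn1.
  move: yP => /link_subA /IP; rewrite !prime_idealrM.
  by rewrite (negbTE uP) (negbTE FP).
apply: (unmixed_height_gap unA hA hB AP) => b /link_mulB /IP.
rewrite prime_idealrM => /orP[|//].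
rewrite in_variable_prime => /allP /(_ U_(t)%MM).
rewrite mcoeff_msupp => /(_ ft) /negP[]; apply/forall_inP => i.
by rewrite inE mnm1E => iF'; have [ti|//] := eqVneq t i; rewrite -ti tF in iF'.
Qed.

End Link.

(** * The circulant graph *)

Local Notation C16 := (circulant 16 [:: 1; 4; 8]%N).

Definition adj16 (i j : nat) : bool :=
  (i != j) && has (fun t => (i == j + t %[mod 16]) || (j == i + t %[mod 16]))%N
    [:: 1; 4; 8]%N.

Lemma C16E i j : C16 i j = adj16 i j.
Proof. by []. Qed.

Lemma C16_irr : irreflexive C16.
Proof. by move=> i; rewrite C16E /adj16 eqxx. Qed.

Lemma C16_sym : ssrbool.symmetric C16.
Proof.
move=> i j; rewrite !C16E /adj16 eq_sym; congr (_ && _).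
by apply: eq_has => t; rewrite orbC.
Qed.

Definition forall16 (P : nat -> bool) := all P (iota 0 16).

Lemma forall16P P : forall16 P -> forall i : 'I_16, P i.
Proof. by move=> /allP H i; apply: H; rewrite mem_iota /= ltn_ord. Qed.

Definition rot16 (t i : nat) : nat := ((i + t) %% 16)%N.

(** The rotation of the graph by t; it transports the computations made with 0 as the
deleted vertex to an arbitrary vertex t. *)
Definition shift (t i : 'I_16) : 'I_16 := inord (rot16 t i).

Lemma shift_val t i : shift t i = rot16 t i :> nat.
Proof. by rewrite inordK // ltn_pmod. Qed.

Lemma adj16_rot : forall16 (fun t => forall16 (fun i => forall16 (fun j =>
  adj16 (rot16 t i) (rot16 t j) == adj16 i j))).
Proof. by vm_compute. Qed.

Lemma C16_shift t i j : C16 (shift t i) (shift t j) = C16 i j.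
Proof.
rewrite !C16E !shift_val; apply/eqP.
exact: (forall16P (forall16P (forall16P adj16_rot t) i) j).
Qed.

Lemma shift_inj t : injective (shift t).
Proof.
have H : forall16 (fun t => forall16 (fun i => forall16 (fun j =>
    (rot16 t i == rot16 t j) ==> (i == j)))) by vm_compute.
move=> i j /(congr1 (@nat_of_ord 16)); rewrite !shift_val => /eqP E; apply/ord_inj/eqP.
by move: E; apply/implyP; apply: (forall16P (forall16P (forall16P H t) i) j).
Qed.

Lemma shift0 t : shift t ord0 = t.
Proof. by apply: ord_inj; rewrite shift_val /rot16 add0n modn_small. Qed.

Lemma shift_surj t j : exists i, j = shift t i.
Proof. by have [g _ gK] := injF_bij (@shift_inj t); exists (g j). Qed.

(** For a triangle t, t', v in a coset of 4Z with fourth element w, the wings are v + 1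
and w - 1. They are adjacent neither to each other nor to t, but v + 1 is adjacent to v and
to t + 1, and w - 1 to w and to t - 1. The sum of the coset is 4 (t mod 4) + 8 modulo 16,
which gives w; the number 71 is 8 - 1 + 64, where 64 avoids negative numbers. *)
Definition wing1 (t t' v : nat) := ((v + 1) %% 16)%N.
Definition wing2 (t t' v : nat) := ((t %% 4 * 4 + 71 - t - t' - v) %% 16)%N.

Lemma wings16 : forall16 (fun t => forall16 (fun t' => if ~~ adj16 t t' then true else
  forall16 (fun v => if ~~ (adj16 t v && adj16 t' v) then true else
  let a := wing1 t t' v in let b := wing2 t t' v in
  [&& ~~ adj16 a b, a != t, ~~ adj16 a t, b != t, ~~ adj16 b t &
    forall16 (fun u => adj16 t u ==> [|| u == t', adj16 u a | adj16 u b])]))).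
Proof. by vm_compute. Qed.

Lemma C16_wings (t t' v : 'I_16) : C16 t t' -> C16 t v -> C16 t' v ->
  exists a b : 'I_16, [/\ ~~ C16 a b, (a != t) && ~~ C16 a t, (b != t) && ~~ C16 b t &
    forall u, C16 t u -> [|| u == t', C16 u a | C16 u b]].
Proof.
rewrite !C16E => tt' tv t'v.
have := forall16P (forall16P wings16 t) t'; rewrite tt' /= => /forall16P /(_ v).
rewrite tv t'v /= => /and5P[ab at_ nat_ bt /andP[nbt /forall16P H]].
pose a : 'I_16 := inord (wing1 t t' v); pose b : 'I_16 := inord (wing2 t t' v).
have aE : a = wing1 t t' v :> nat by rewrite inordK // ltn_pmod.
have bE : b = wing2 t t' v :> nat by rewrite inordK // ltn_pmod.
exists a, b; rewrite !C16E aE bE ab nat_ nbt !andbT; split=> //.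
- by apply: contra at_ => /eqP E; rewrite -aE E.
- by apply: contra bt => /eqP E; rewrite -bE E.
by move=> u; rewrite !C16E aE bE => tu; apply: (implyP (H u)).
Qed.

(** A 2-cocycle of the complex of independent sets avoiding 0, found by computer search:
it takes the value 1 on these five triangles, ordered by residue modulo 4. *)
Definition triangles : seq (nat * nat * nat) :=
  [:: (12, 9, 7); (9, 14, 3); (5, 2, 7); (12, 9, 14); (12, 2, 7)]%N.

(** Even rearrangements of the listed triangles; odd ones are in [tri_neg]. *)
Definition tri_pos (i j k : nat) : bool :=
  has (mem triangles) [:: (i, j, k); (j, k, i); (k, i, j)].

Definition tri_neg (i j k : nat) : bool := tri_pos j i k.

Lemma cocycle16 : forall16 (fun i => forall16 (fun j => if adj16 i j then true else
  forall16 (fun k => if adj16 i k || adj16 j k then true else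
  forall16 (fun l => if [|| adj16 i l, adj16 j l | adj16 k l] then true else
  [|| i == 0, j == 0, k == 0, l == 0 |
  tri_pos j k l + tri_neg i k l + tri_pos i j l + tri_neg i j k ==
  tri_neg j k l + tri_pos i k l + tri_neg i j l + tri_pos i j k]))))%N.
Proof. by vm_compute. Qed.

Definition tri_coef (i j k : 'I_16) : rat := (tri_pos i j k)%:R - (tri_neg i j k)%:R.

Lemma tri_cocycle (i j k l : 'I_16) :
  ~~ [|| C16 i j, C16 i k, C16 j k, C16 i l, C16 j l | C16 k l] ->
  [&& i != ord0, j != ord0, k != ord0 & l != ord0] ->
  tri_coef j k l - tri_coef i k l + tri_coef i j l - tri_coef i j k = 0.
Proof.
rewrite !negb_or => /and5P[ij ik jk il /andP[jl kl]] /and4P[i0 j0 k0 l0].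
have := forall16P (forall16P cocycle16 i) j; rewrite -C16E (negbTE ij).
move=> /forall16P /(_ k); rewrite -!C16E (negbTE ik) (negbTE jk).
move=> /forall16P /(_ l); rewrite -!C16E (negbTE il) (negbTE jl) (negbTE kl).
rewrite -[(i : nat) == 0%N]/(i == ord0) (negbTE i0)
  -[(j : nat) == 0%N]/(j == ord0) (negbTE j0).
rewrite -[(k : nat) == 0%N]/(k == ord0) (negbTE k0)
  -[(l : nat) == 0%N]/(l == ord0) (negbTE l0).
move=> /= /eqP /(congr1 (fun n => n%:R : rat)); rewrite !natrD => E.
have balance (p1 n1 p2 n2 p3 n3 p4 n4 : rat) :
    p1 + n2 + p3 + n4 = n1 + p2 + n3 + p4 ->
    (p1 - n1) - (p2 - n2) + (p3 - n3) - (p4 - n4) = 0.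
  by move=> E'; rewrite -(subrr (n1 + p2 + n3 + p4)) -{1}E'; ring.
exact: balance.
Qed.

Section TriangleCochain.
Variable t : 'I_16.
Local Notation S := {mpoly rat[16]}.
Local Notation I := (edge_ideal rat C16).

Definition xvar (i : 'I_16) : S := 'X_(shift t i).

Definition tri_cochain (s : seq 'I_16) : S :=
  if s is [:: i; j; k] then tri_coef i j k *: (xvar i * xvar j * xvar k) else 0.

Lemma edge_quadruple i j k l :
  [|| C16 i j, C16 i k, C16 j k, C16 i l, C16 j l | C16 k l] ->
  xvar i * xvar j * xvar k * xvar l \in I.
Proof.
have xI a b p : C16 a b -> xvar a * xvar b * p \in I.
  move=> ab; rewrite mulrC idealMr //; apply/asboolP/ideal_gen1.
  by exists (shift t a), (shift t b); rewrite C16_shift.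
case/or4P=> [E|E|E|/or3P[] E].
- have -> : xvar i * xvar j * xvar k * xvar l =
    xvar i * xvar j * (xvar k * xvar l) by ring.
  exact: xI.
- have -> : xvar i * xvar j * xvar k * xvar l =
    xvar i * xvar k * (xvar j * xvar l) by ring.
  exact: xI.
- have -> : xvar i * xvar j * xvar k * xvar l =
    xvar j * xvar k * (xvar i * xvar l) by ring.
  exact: xI.
- have -> : xvar i * xvar j * xvar k * xvar l =
    xvar i * xvar l * (xvar j * xvar k) by ring.
  exact: xI.
- have -> : xvar i * xvar j * xvar k * xvar l =
    xvar j * xvar l * (xvar i * xvar k) by ring.
  exact: xI.
- have -> : xvar i * xvar j * xvar k * xvar l =
    xvar k * xvar l * (xvar i * xvar j) by ring.
  exact: xI.
Qed.

Lemma tri_cochain_cocycle s : size s = 4%N ->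
  exists p, cobd xvar tri_cochain s - 'X_t * p \in I.
Proof.
case: s => [|i [|j [|k [|l [|//]]]]] // _.
have -> : cobd xvar tri_cochain [:: i; j; k; l] =
    (tri_coef j k l - tri_coef i k l + tri_coef i j l - tri_coef i j k) *:
      (xvar i * xvar j * xvar k * xvar l).
  by rewrite /= -!mul_mpolyC !(mpolyCB, mpolyCD); ring.
have [E|noE] := boolP [|| C16 i j, C16 i k, C16 j k, C16 i l, C16 j l | C16 k l].
  by exists 0; rewrite mulr0 subr0 -mul_mpolyC idealMr // edge_quadruple.
have [n0|] := boolP [&& i != ord0, j != ord0, k != ord0 & l != ord0].
  by exists 0; rewrite tri_cocycle // scale0r mulr0 subr0 rpred0.
rewrite !negb_and !negbK => E; set b := (X in X *: _).
suff [w ->] : exists w, xvar i * xvar j * xvar k * xvar l = 'X_t * w.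
  by exists (b *: w); rewrite -scalerAr subrr rpred0.
have x0 : xvar ord0 = 'X_t by rewrite /xvar shift0.
case/or4P: E => /eqP ->; rewrite x0.
- by exists (xvar j * xvar k * xvar l); ring.
- by exists (xvar i * xvar k * xvar l); ring.
- by exists (xvar i * xvar j * xvar l); ring.
- by exists (xvar i * xvar j * xvar k); ring.
Qed.

Lemma tri_cochain_not_coboundary (q : S) (h : seq 'I_16 -> S) : q@_0%MM != 0 ->
  ~ (forall s, size s = 3%N ->
       exists p, q * tri_cochain s - cobd xvar h s - 'X_t * p \in I).
Proof.
move=> q0 hE; pose u i : 'X_{1..16} := U_(shift t i)%MM.
pose H i j := (h [:: i; j])@_(u i + u j)%MM.
have t_free w (m : 'X_{1..16}) : m t = 0%N -> ('X_t * w)@_m = 0.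
  move=> mt; apply/eqP; rewrite mcoeff_eq0; apply/negP => /msuppM_le.
  move=> /allpairsP[[m1 m2] /= []]; rewrite msuppX inE => /eqP-> _ E.
  by move: mt; rewrite E mnmDE mnm1E eqxx.
(* No element of I + (x_t) involves the squarefree monomial m of a face of the
   complex, and multiplying by q scales its coefficient by q(0). *)
have key (i j k : 'I_16) : ~~ [|| C16 i j, C16 i k | C16 j k] ->
    [&& i != ord0, j != ord0 & k != ord0] ->
    q@_0%MM * tri_coef i j k = H j k - H i k + H i j.
  rewrite !negb_or => /and3P[ij ik jk] /and3P[i0 j0 k0].
  have [w wI] := hE [:: i; j; k] erefl.
  pose m := (u i + u j + u k)%MM.
  have mt : m t = 0%N.
    have ut l : l != ord0 -> u l t = 0%N.
      by rewrite mnm1E -(inj_eq (@shift_inj t)) shift0 => /negbTE->.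
    by rewrite !mnmDE !ut.
  have noE : ~~ has_edge C16 m.
    have mP b : (0 < m b)%N -> [|| b == shift t i, b == shift t j | b == shift t k].
      rewrite !mnmDE !mnm1E ![b == _]eq_sym.
      by case: (shift t i == b); case: (shift t j == b); case: (shift t k == b).
    apply/negP => /has_edgeP[b [b' [ebb /mP bE /mP b'E]]]; move: ebb.
    by case/or3P: bE => /eqP->; case/or3P: b'E => /eqP->;
      rewrite C16_shift ?C16_irr // 1?C16_sym; apply/negP => //; rewrite C16_sym.
  have : (q * tri_cochain [:: i; j; k] - cobd xvar h [:: i; j; k] - 'X_t * w)@_m = 0.
    apply/eqP; rewrite mcoeff_eq0; apply: contra noE.
    exact: (edge_idealP C16_irr _ wI).
  rewrite !mcoeffB t_free // subr0 => /eqP; rewrite subr_eq0 => /eqP.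
  have -> : tri_cochain [:: i; j; k] = tri_coef i j k *: 'X_[m] by rewrite !mpolyXD.
  have qm : (q * 'X_[m])@_m = q@_0%MM by have := mcoeffMX q m 0%MM; rewrite addm0.
  rewrite -scalerAr mcoeffZ qm mulrC => ->.
  have xH l p m' : (xvar l * p)@_(u l + m')%MM = p@_m' by rewrite mulrC mcoeffMX.
  have E1 : (xvar i * h [:: j; k])@_m = H j k by rewrite /m -addmA xH.
  have E2 : (xvar j * h [:: i; k])@_m = H i k.
    by rewrite /m [(u i + _)%MM]addmC -addmA xH.
  have E3 : (xvar k * h [:: i; j])@_m = H i j by rewrite /m addmC xH.
  by rewrite /= E1 E2 E3 mcoeff0; ring.
have {}key i j k b : (i < 16)%N -> (j < 16)%N -> (k < 16)%N ->
    ~~ [|| adj16 i j, adj16 i k | adj16 j k] -> [&& i != 0, j != 0 & k != 0]%N ->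
    tri_pos i j k = b -> tri_neg i j k = false ->
    q@_0%MM * b%:R =
    H (inord j) (inord k) - H (inord i) (inord k) + H (inord i) (inord j).
  move=> i16 j16 k16 adj /and3P[i0 j0 k0] pE nE.
  rewrite -key /tri_coef ?C16E ?inordK ?pE ?nE ?subr0 //.
  by rewrite -!(inj_eq val_inj) /= !inordK // i0 j0.
move/eqP: q0; apply.
(* The faces of the octahedron with opposite vertices 5 and 9, 2 and 14, 7 and 11:
   the signed sum of the eight equations cancels every H, and the cocycle is zero on
   all of them except 5, 2, 7. *)
have E1 := key 5 2 7 true isT isT isT isT isT erefl erefl.
have E2 := key 5 2 11 false isT isT isT isT isT erefl erefl.
have E3 := key 5 14 7 false isT isT isT isT isT erefl erefl.
have E4 := key 5 14 11 false isT isT isT isT isT erefl erefl.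
have E5 := key 9 2 7 false isT isT isT isT isT erefl erefl.
have E6 := key 9 2 11 false isT isT isT isT isT erefl erefl.
have E7 := key 9 14 7 false isT isT isT isT isT erefl erefl.
have E8 := key 9 14 11 false isT isT isT isT isT erefl erefl.
move: E1 E2 E3 E4 E5 E6 E7 E8; rewrite !mulr0 mulr1; lra.
Qed.

End TriangleCochain.

Section Link16.
Local Notation S := {mpoly rat[16]}.
Local Notation I := (edge_ideal rat C16).
Variables (d : nat) (f : S) (A B : idealr S).
Hypotheses (monB : monomial_ideal B) (GL : basic_double_Glink d f A B I).

(** Either the support of f contains two non-adjacent vertices a, b, and then
sigma = {a, b} with f vanishing at the point (c_b, -c_a); or the support is a clique, and
then sigma consists of the wings of t, t', v, on which f has no support. *)
Lemma no_link_two (t t' : 'I_16) :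
  t != t' -> f@_U_(t) != 0 -> f@_U_(t') != 0 -> False.
Proof.
move=> tt' ft ft'; have [_ [v vB]] := link_linear monB GL.
have supp_v u : f@_U_(u) != 0 -> C16 u v.
  exact: (link_neighbour C16_irr C16_sym GL vB).
have supp_edge m u := @link_support_edge _ _ _ C16_irr _ _ _ _ GL m u.
have two_points a b (p : 'I_16 -> rat) : 'X_[U_(a) + U_(b)].@[p] = p a * p b.
  by rewrite mpolyXD mevalM !mevalXU.
have [[a [b [fa fb ab nab]]]|allT] :=
    EM (exists a b, [/\ f@_U_(a) != 0, f@_U_(b) != 0, a != b & ~~ C16 a b]).
  have iab : independent C16 [set a; b].
    apply/independentP => x y; rewrite !inE => /orP[] /eqP -> /orP[] /eqP ->;
      by rewrite ?C16_irr // C16_sym.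
  have [F [sF iF maxF]] := facet_exists C16_irr C16_sym iab.
  have aF : a \in F by apply: (fintype.subsetP sF); rewrite !inE eqxx.
  have bF : b \in F by apply: (fintype.subsetP sF); rewrite !inE eqxx orbT.
  pose p i := if i == a then f@_U_(b) else if i == b then - f@_U_(a) else 0.
  apply: (link_obstruction C16_irr monB GL (s := (U_(a) + U_(b))%MM) (p := p) iF maxF).
  - exact: (ex_intro2 _ _ a aF fa).
  - move=> i iF'; rewrite /p; have [E|_] := eqVneq i a; first by rewrite E aF in iF'.
    by have [E|//] := eqVneq i b; rewrite E bF in iF'.
  - rewrite (link_meval monB GL) (bigD1 a) //= (bigD1 b) 1?eq_sym //=.
    rewrite big1 => [|i /andP[ia ib]].
      by rewrite /p eqxx [b == a]eq_sym (negbTE ab) eqxx; ring.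
    by rewrite /p (negbTE ia) (negbTE ib) mulr0.
  - rewrite two_points /p eqxx [b == a]eq_sym (negbTE ab) eqxx.
    by apply: mulf_neq0 fb _; rewrite oppr_eq0; exact: fa.
  move=> m /supp_edge /(_ fa); rewrite [(U_(a) + U_(b))%MM]addmC -addmA.
  exact: has_edge_add.
have adjT a b : f@_U_(a) != 0 -> f@_U_(b) != 0 -> a != b -> C16 a b.
  by move=> fa fb ab; apply: contraT => nab; case: allT; exists a, b.
have ett' := adjT _ _ ft ft' tt'.
have [a [b [ab /andP[at' nat'] /andP[bt nbt] wings]]] :=
  C16_wings ett' (supp_v _ ft) (supp_v _ ft').
have itab : independent C16 [set t; a; b].
  apply/independentP => x y; rewrite !inE -!orbA => /or3P[] /eqP -> /or3P[] /eqP ->;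
    by rewrite ?C16_irr // C16_sym.
have [F [sF iF maxF]] := facet_exists C16_irr C16_sym itab.
have tF : t \in F by apply: (fintype.subsetP sF); rewrite !inE eqxx.
have aF : a \in F by apply: (fintype.subsetP sF); rewrite !inE eqxx orbT.
have bF : b \in F by apply: (fintype.subsetP sF); rewrite !inE eqxx orbT.
pose p i : rat := ((i == a) || (i == b))%:R.
have nT u : u != t -> ~~ C16 u t -> f@_U_(u) = 0.
  move=> ut nut; apply/eqP; apply: contraT => fu.
  by have := adjT _ _ fu ft ut; rewrite (negbTE nut).
apply: (link_obstruction C16_irr monB GL (s := (U_(a) + U_(b))%MM) (p := p) iF maxF).
- exact: (ex_intro2 _ _ t tF ft).
- move=> i iF'; rewrite /p; have [E|_] := eqVneq i a; first by rewrite E aF in iF'.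
  by have [E|//] := eqVneq i b; rewrite E bF in iF'.
- rewrite (link_meval monB GL) big1 // => i _; rewrite /p.
  have [->|_] := eqVneq i a; first by rewrite nT ?mul0r.
  by have [->|_] := eqVneq i b; [rewrite nT ?mul0r | rewrite mulr0].
- by rewrite two_points /p !eqxx orbT mulr1 oner_eq0.
have in_m (m : 'X_{1..16}) u x : (0 < m u)%N -> (0 < (U_(u) + m)%MM x)%N -> (0 < m x)%N.
  by move=> mu; rewrite mnmDE mnm1E; have [<-//|_] := eqVneq u x.
have not_t (m : 'X_{1..16}) x : x != t -> (0 < (U_(t) + m)%MM x)%N -> (0 < m x)%N.
  by move=> xt; rewrite mnmDE mnm1E eq_sym (negbTE xt).
(* A neighbour x of t is adjacent to a or to b unless it is t', and x_{t'} x^m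
   is in I because t' is in the support of f. *)
have near m x : 'X_[m] \in B -> C16 t x -> (0 < m x)%N ->
    has_edge C16 (U_(a) + U_(b) + m)%MM.
  move=> mB tx mx; have /or3P[/eqP xt'|xa|xb] := wings x tx.
  - have /has_edgeP[i [j [eij i0 j0]]] := supp_edge _ _ mB ft'.
    apply: has_edge_add; apply/has_edgeP; exists i, j; rewrite xt' in mx.
    by split=> //; apply: in_m mx _.
  - apply/has_edgeP; exists x, a; rewrite !mnmDE !mnm1E eqxx !addn_gt0 mx !orbT.
    by split.
  - apply/has_edgeP; exists x, b; rewrite !mnmDE !mnm1E eqxx !addn_gt0 mx !orbT.
    by split.
move=> m mB; have /has_edgeP[i [j [eij i0 j0]]] := supp_edge _ _ mB ft.
have ij : i != j by apply: contraTneq eij => ->; rewrite C16_irr.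
have [it|it] := eqVneq i t.
  by apply: (near m j) => //; [rewrite -it | apply: not_t j0; rewrite eq_sym -it].
have [jt|jt] := eqVneq j t.
  by apply: (near m i) => //; [rewrite C16_sym -jt | apply: not_t i0].
apply: has_edge_add; apply/has_edgeP; exists i, j.
by split=> //; apply: not_t.
Qed.

(** A facet of the complex of independent sets avoiding 0; dropping its elements one by
one gives the chain of monomial primes from its component up to the origin. *)
Definition facet16 : seq nat := [:: 2; 4; 7; 9]%N.

Definition chain_vars (t : 'I_16) (i : nat) : {set 'I_16} :=
  ~: [set shift t j | j : 'I_16 & (j : nat) \in drop i facet16].

Lemma in_chain_vars t i j :
  (shift t j \in chain_vars t i) = ((j : nat) \notin drop i facet16).
Proof. by rewrite inE mem_imset ?inE //; apply: shift_inj. Qed.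

Lemma facet16_independent : forall16 (fun i => forall16 (fun j =>
  adj16 i j ==> ((i \notin facet16) || (j \notin facet16)))).
Proof. by vm_compute. Qed.

Lemma chain_vars_cover t i j k : C16 j k ->
  (j \in chain_vars t i) || (k \in chain_vars t i).
Proof.
have [j' ->] := shift_surj t j; have [k' ->] := shift_surj t k.
rewrite C16_shift !in_chain_vars => jk.
have /implyP /(_ jk) := forall16P (forall16P facet16_independent j') k'.
by case/orP => H; apply/orP; [left | right];
  apply: contra H; apply: mem_drop.
Qed.

Lemma chain_varsS t i : chain_vars t i \subset chain_vars t i.+1.
Proof.
rewrite setCS; apply: imsetS; apply/fintype.subsetP => j; rewrite !inE.
by rewrite -[i.+1]add1n -drop_drop => /mem_drop.
Qed.

Lemma chain_vars_strict t i : (i < 4)%N -> exists2 u, u \in chain_vars t i.+1 &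
  u \notin chain_vars t i.
Proof.
move=> i4; pose j : 'I_16 := inord (nth 0 facet16 i).
have jE : j = nth 0 facet16 i :> nat.
  by rewrite inordK //; case: i i4 {j} => [|[|[|[|]]]].
exists (shift t j); rewrite in_chain_vars jE ?negbK;
  by case: i i4 {j jE} => [|[|[|[|]]]].
Qed.

(** The prime of the facet contains x_t, a nonzerodivisor modulo A, so it is not minimal
over A: there is a prime Q below it, which gives the fifth step of the chain. *)
Lemma single_prime_chain (t : 'I_16) (a : rat) : f = a *: 'X_t -> a != 0 ->
  exists c : nat -> prime_idealr S, prime_chain c 5 /\
    forall i, {subset A <= c i} /\ {subset c i <= variable_prime rat [set: 'I_16]}.
Proof.
move=> fE a0; pose P i := variable_prime rat (chain_vars t i).
have AP i : {subset A <= P i}.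
  move=> b /(link_subA GL); apply: edge_ideal_prime; first exact: C16_irr.
  exact: chain_vars_cover.
have tA k s : 'X_t ^+ k * s \in A -> s \in A.
  elim: k => [|k IH]; first by rewrite expr0 mul1r.
  rewrite exprS -mulrA => H; apply/IH/(link_nonzerodivisor GL).
  by rewrite fE -scalerAl -mul_mpolyC idealMr.
have [k s sP|Q [AQ QP tQ]] := @prime_below_avoiding S A (P 0%N) 'X_t.
  by apply: contra sP => /tA /AP.
exists (fun i => if i is i'.+1 then P i' else Q); split=> [[_|i i4]|i].
- have tP : 'X_t \in P 0%N.
    by rewrite variable_primeXU -[X in X \in _]shift0 in_chain_vars.
  by split=> // /(_ _ tP); apply/negP.
- split; first by apply: variable_primeS; apply: chain_varsS.
  have [u uW uW'] := chain_vars_strict t (i4 : (i < 4)%N).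
  exact: (variable_prime_not_sub uW uW').
- split; first by case: i.
  move=> y yc; have: y \in P i.-1 by case: i yc => [/QP|].
  exact: (variable_primeS (finset.subsetT _)).
Qed.

(** As I = f B + A, the ideals I + (x_t) and A + (f) are equal. So the triangle cochain is
a cocycle modulo A + (f), and q times it would be a coboundary modulo I + (x_t). *)
Lemma no_link_one (t : 'I_16) (a : rat) : f = a *: 'X_t -> a != 0 -> False.
Proof.
move=> fE a0; have [c [c5 cM]] := single_prime_chain fE a0.
have AM : {subset A <= variable_prime rat [set: 'I_16]}.
  by move=> b bA; apply: (cM 0%N).2; apply: (cM 0%N).1.
have xM p : p \in variable_prime rat [set: 'I_16] ->
    exists b, p = \sum_j b j * xvar t j.
  move=> /variable_prime_sum[b ->]; have sinj := @shift_inj t.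
  by exists (b \o shift t); rewrite (reindex_inj sinj).
have [s s4|q qM [h hE]] := @CM_cocycle S A _ AM 16 (xvar t) 5 c f (tri_cochain t) 3
    (bdl_CM GL) (@origin_maximal rat 16) cM c5 xM
    (fun p => @link_nonzerodivisor _ _ _ _ _ _ _ GL p) isT.
  have [p /(bdl_eq GL)[b [b' [bA _ E]]]] := tri_cochain_cocycle t s4.
  have fp : f * (a^-1 *: p) = 'X_t * p.
    by rewrite fE -scalerAl -scalerAr scalerA divff // scale1r.
  have -> : cobd (xvar t) (tri_cochain t) s = f * b' + b + 'X_t * p by rewrite -E subrK.
  exists (b' + a^-1 *: p); rewrite mulrDr fp.
  by have -> : f * b' + b + 'X_t * p - (f * b' + 'X_t * p) = b by ring.
apply: (tri_cochain_not_coboundary (t := t) (q := q) (h := h)).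
  by rewrite -origin_prime.
move=> s /hE[w wA]; exists (a *: w); rewrite -scalerAr scalerAl -fE.
exact: link_subA GL _ wA.
Qed.

End Link16.

Theorem proposition3p10 :
  ~ exists (d : nat) (f : {mpoly rat[16]}) (A B : idealr {mpoly rat[16]}),
      monomial_ideal B /\
      basic_double_Glink d f A B (edge_ideal rat (circulant 16 [:: 1; 4; 8]%N)).
Proof.
move=> [d [f [A [B [monB GL]]]]]; have [t ft] := link_support monB GL.
have [[t' t't ft']|single] := EM (exists2 t', t' != t & f@_U_(t') != 0).
  exact: (no_link_two monB GL t't ft' ft).
suff fE : f = f@_U_(t) *: 'X_t by exact: (no_link_one GL fE ft).
rewrite {1}(link_form monB GL) (bigD1 t) //= [X in _ + X]big1 ?addr0 // => t' t't.
have [->|ft'] := eqVneq (f@_U_(t')) 0; first by rewrite scale0r.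
by case: single; exists t'.
Qed.
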